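(* Let $G$ be one of the following groups: (1) $G=H_\sigma=\left\langle a_1,\dots,a_n \;\middle|\; a_i a_{i+1}^{m_i} a_i^{-1}=a_{i+1}^{n_i}\ \text{for } i\in\mathbb{Z}/n\mathbb{Z}\right\rangle$, where $n\ge5$ and $\sigma=\bigl((m_1,n_1),\dots,(m_n,n_n)\bigr)$ with $m_i,n_i\in\mathbb{Z}\setminus\{0\}$ and $|m_i|\neq|n_i|$ for all $i$; or (2) $G=H(m_i)_{i\in\mathbb{Z}/4\mathbb{Z}}=\left\langle a_1,a_2,a_3,a_4 \;\middle|\; a_i a_{i+1} a_i^{-1}=a_{i+1}^{m_i}\ \text{for all } i\in\mathbb{Z}/4\mathbb{Z}\right\rangle$, where $m_i\ge2$ are integers. Then $G$ is acylindrically hyperbolic.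
   Context: Indices of generators are taken modulo $n$ (with $n=4$ in case (2)). An isometric action of a group $\Gamma$ on a metric space $Y$ is acylindrical if for every $\varepsilon>0$ there exist $R,N>0$ such that whenever $x,y\in Y$ satisfy $d(x,y)\ge R$, there are at most $N$ elements $g\in\Gamma$ with $d(x,gx)\le\varepsilon$ and $d(y,gy)\le\varepsilon$. An isometric action on a geodesic Gromov-hyperbolic space $Y$ is non-elementary if the group contains two loxodromic elements whose fixed-point sets in the Gromov boundary $\partial Y$ are disjoint. A group is acylindrically hyperbolic if it admits a non-elementary acylindrical isometric action on a geodesic Gromov-hyperbolic space. *)

(* Defs.v *)
From HB Require Import structures.
From mathcomp Require Import all_boot all_order all_algebra.
From mathcomp Require Import all_classical all_reals all_analysis.

Set Implicit Arguments.
Unset Strict Implicit.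
Unset Printing Implicit Defensive.

Import Order.TTheory GRing.Theory Num.Theory.

Local Open Scope classical_set_scope.
Local Open Scope card_scope.
Local Open Scope ring_scope.

Definition expgz (G : groupType) (g : G) (z : int) : G :=
  match z with
  | Posz k => (g ^+ k)%g
  | Negz k => (g ^- k.+1)%g
  end.

Section PresentedGroup.
Variable X : choiceType.

(* The letter (x, false) stands for x and (x, true) for its inverse. *)
Definition word := seq (X * bool).

Definition invl (l : X * bool) : X * bool := (l.1, ~~ l.2).
Definition invw (w : word) : word := rev (map invl w).

Definition wgen (x : X) : word := [:: (x, false)].
Definition wexpz (x : X) (z : int) : word := nseq `|z|%N (x, z < 0).

(* A pair (u, v) in rels is the relation u = v. *)
Variable rels : set (word * word).

Inductive pres_eq : word -> word -> Prop :=
| pres_refl u : pres_eq u u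
| pres_sym u v : pres_eq u v -> pres_eq v u
| pres_trans u v w : pres_eq u v -> pres_eq v w -> pres_eq u w
| pres_cat u u' v v' :
    pres_eq u u' -> pres_eq v v' -> pres_eq (u ++ v) (u' ++ v')
| pres_cancel l : pres_eq [:: l; invl l] [::]
| pres_rel u v : rels (u, v) -> pres_eq u v.

Definition pres_eqb : rel word := fun u v => `[< pres_eq u v >].

Lemma pres_eqb_refl : reflexive pres_eqb.
Proof. by move=> u; apply/asboolP; exact: pres_refl. Qed.

Lemma pres_eqb_sym : symmetric pres_eqb.
Proof. by move=> u v; apply/asboolP/asboolP; exact: pres_sym. Qed.

Lemma pres_eqb_trans : transitive pres_eqb.
Proof.
by move=> v u w /asboolP uv /asboolP vw; apply/asboolP; exact: pres_trans vw.
Qed.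

Canonical pres_equiv := EquivRel pres_eqb pres_eqb_refl pres_eqb_sym pres_eqb_trans.

Local Open Scope quotient_scope.

Definition presented := {eq_quot pres_equiv}.
HB.instance Definition _ := EqQuotient.on presented.
HB.instance Definition _ := Choice.on presented.

Definition pres_class (w : word) : presented := \pi_presented w.

Lemma pres_classP u v : pres_class u = pres_class v <-> pres_eq u v.
Proof. by split=> [/eqmodP/asboolP //|h]; apply/eqmodP/asboolP. Qed.

Lemma pres_classK (a : presented) : pres_class (repr a) = a.
Proof. exact: reprK. Qed.

Lemma pres_repr u : pres_eq (repr (pres_class u)) u.
Proof. by apply/pres_classP; rewrite pres_classK. Qed.

Lemma invlK : involutive invl.
Proof. by case=> x b; rewrite /invl /= negbK. Qed.

Lemma invwK : involutive invw.
Proof.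
by move=> w; rewrite /invw map_rev revK -map_comp map_id_in // => l _ /=; rewrite invlK.
Qed.

Lemma invw_cat u v : invw (u ++ v) = invw v ++ invw u.
Proof. by rewrite /invw map_cat rev_cat. Qed.

Lemma pres_mulwV w : pres_eq (w ++ invw w) [::].
Proof.
elim: w => [|l w IHw]; first exact: pres_refl.
have -> : (l :: w) ++ invw (l :: w) = [:: l] ++ (w ++ invw w) ++ [:: invl l].
  by rewrite /invw /= rev_cons -cats1 !catA.
apply: pres_trans (pres_cancel l).
apply: (@pres_cat [:: l] [:: l] _ [:: invl l]); first exact: pres_refl.
by apply: (@pres_cat _ [::] [:: invl l]) => //; exact: pres_refl.
Qed.

Lemma pres_invw u v : pres_eq u v -> pres_eq (invw u) (invw v).
Proof.
move=> uv; apply: (@pres_trans _ (invw u ++ (v ++ invw v))).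
  rewrite -{1}[invw u]cats0; apply: pres_cat; first exact: pres_refl.
  exact/pres_sym/pres_mulwV.
rewrite catA -[X in pres_eq _ X]cat0s; apply: pres_cat; last exact: pres_refl.
apply: (@pres_trans _ (invw u ++ u)).
  by apply: pres_cat; [exact: pres_refl|exact: pres_sym].
by rewrite -{2}[u]invwK; exact: pres_mulwV.
Qed.

Definition pres_one : presented := pres_class [::].
Definition pres_mul (a b : presented) : presented :=
  pres_class (repr a ++ repr b).
Definition pres_inv (a : presented) : presented := pres_class (invw (repr a)).

Lemma pres_mulE u v :
  pres_mul (pres_class u) (pres_class v) = pres_class (u ++ v).
Proof. by apply/pres_classP; apply: pres_cat; exact: pres_repr. Qed.

Lemma pres_invE u : pres_inv (pres_class u) = pres_class (invw u).
Proof. by apply/pres_classP; apply: pres_invw; exact: pres_repr. Qed.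

Lemma pres_mulA : associative pres_mul.
Proof.
move=> a b c; rewrite -(pres_classK a) -(pres_classK b) -(pres_classK c).
by rewrite !pres_mulE catA.
Qed.

Lemma pres_mul1 : left_id pres_one pres_mul.
Proof. by move=> a; rewrite -(pres_classK a) pres_mulE. Qed.

Lemma pres_mul1r : right_id pres_one pres_mul.
Proof. by move=> a; rewrite -(pres_classK a) pres_mulE cats0. Qed.

Lemma pres_mulV : right_inverse pres_one pres_inv pres_mul.
Proof.
move=> a; rewrite -(pres_classK a) pres_invE pres_mulE.
exact/pres_classP/pres_mulwV.
Qed.

Lemma pres_mulVl : left_inverse pres_one pres_inv pres_mul.
Proof.
move=> a; rewrite -(pres_classK a) pres_invE pres_mulE.
by apply/pres_classP; rewrite -{2}[repr a]invwK; exact: pres_mulwV.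
Qed.

HB.instance Definition _ := isGroup.Build presented
  pres_mulA pres_mul1 pres_mul1r pres_mulVl pres_mulV.

Definition pres_gen (x : X) : presented := pres_class (wgen x).

Definition evall (G : groupType) (f : X -> G) (l : X * bool) : G :=
  if l.2 then ((f l.1)^-1)%g else f l.1.
Definition evalw (G : groupType) (f : X -> G) (w : word) : G :=
  foldr (fun l a => (evall f l * a)%g) 1%g w.

Lemma evalw_cat (G : groupType) (f : X -> G) u v :
  evalw f (u ++ v) = (evalw f u * evalw f v)%g.
Proof. by elim: u => [|l u /= ->]; rewrite ?mul1g ?mulgA. Qed.

Lemma evalw_wexpz (G : groupType) (f : X -> G) x z :
  evalw f (wexpz x z) = expgz (f x) z.
Proof.
case: z => k; rewrite /wexpz /=; first by elim: k => [|k /= ->]; rewrite ?expgS.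
rewrite -expVgn; elim: k => [|k IHk]; first by rewrite /= mulg1.
by rewrite expgS /= -IHk.
Qed.

Lemma pres_evalw w : evalw pres_gen w = pres_class w.
Proof.
elim: w => [|[x b] w IHw] //=; rewrite {}IHw -[_ :: w]cat1s -pres_mulE.
by case: b; rewrite /evall //= /pres_gen [X in (X * _)%g]pres_invE.
Qed.

Lemma pres_rels u v : rels (u, v) -> evalw pres_gen u = evalw pres_gen v.
Proof. by move=> uv; rewrite !pres_evalw; exact/pres_classP/pres_rel. Qed.

Lemma pres_univ (G : groupType) (f : X -> G) :
  (forall u v, rels (u, v) -> evalw f u = evalw f v) ->
  exists! h : presented -> G,
    (forall a b, h (a * b)%g = (h a * h b)%g) /\ forall x, h (pres_gen x) = f x.
Proof.
move=> frel.
have fE u v : pres_eq u v -> evalw f u = evalw f v.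
  elim=> {u v} //; first by move=> u v w _ -> _ ->.
    by move=> u u' v v' _ uu' _ vv'; rewrite !evalw_cat uu' vv'.
  by case=> x [] /=; rewrite /evall /= mulg1 ?mulVg ?mulgV.
have hE u : evalw f (repr (pres_class u)) = evalw f u by exact/fE/pres_repr.
exists (fun a => evalw f (repr a)); split.
  split=> [a b|x]; last by rewrite hE /= mulg1.
  by rewrite [(a * b)%g]/(pres_mul a b) hE evalw_cat.
move=> h [hM hgen]; apply/funext => a.
have h1 : h 1%g = 1%g.
  by apply: (@mulgI _ (h 1%g)); rewrite -hM !mulg1.
have hV b : h (b^-1)%g = ((h b)^-1)%g.
  by apply: (@mulgI _ (h b)); rewrite -hM !mulgV.
rewrite -{2}(pres_classK a) -pres_evalw; elim: (repr a) => [|[x b] w IHw] //=.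
by rewrite hM -IHw; case: b; rewrite /evall /= ?hV hgen.
Qed.

End PresentedGroup.

(* a_i a_(i+1)^(m i) a_i^-1 = a_(i+1)^(k i), with ordS the cyclic successor. *)
Definition higman_rels (n : nat) (m k : 'I_n -> int) :
    set (word 'I_n * word 'I_n) :=
  range (fun i : 'I_n =>
    (wgen i ++ wexpz (ordS i) (m i) ++ invw (wgen i), wexpz (ordS i) (k i))).

Definition higman_group (n : nat) (m k : 'I_n -> int) : groupType :=
  presented (higman_rels m k).

Lemma higman_relE (n : nat) (m k : 'I_n -> int) (i : 'I_n) :
  let a : 'I_n -> higman_group m k := @pres_gen _ (higman_rels m k) in
  (a i * expgz (a (ordS i)) (m i) * (a i)^-1)%g = expgz (a (ordS i)) (k i).
Proof.
move=> a; rewrite -!evalw_wexpz -[RHS](pres_rels (rels := higman_rels m k) (u :=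
  wgen i ++ wexpz (ordS i) (m i) ++ invw (wgen i))); last by exists i.
by rewrite !evalw_cat /= !mulg1 mulgA.
Qed.

Section MetricGeometry.
Variables (R : realType) (Y : metricType R).

Definition geodesic_space : Prop :=
  forall x y : Y, exists c : R -> Y,
    [/\ c 0 = x, c (mdist x y) = y &
        forall s t : R, s \in `[0, mdist x y] -> t \in `[0, mdist x y] ->
          mdist (c s) (c t) = `|s - t|].

Definition gromov_product (o x y : Y) : R :=
  (mdist o x + mdist o y - mdist x y) / 2.

Definition gromov_hyperbolic : Prop :=
  exists2 delta : R, 0 <= delta &
    forall o x y z : Y,
      Num.min (gromov_product o x y) (gromov_product o y z) - delta
        <= gromov_product o x z.

Definition gromov_asymptotic (s t : nat -> Y) : Prop :=
  forall (o : Y) (A : R),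
    \forall i \near \oo & j \near \oo, A <= gromov_product o (s i) (t j).

(* A boundary point is an asymptoty class of sequences s converging at
   infinity, i.e. such that gromov_asymptotic s s. *)
Definition boundary_point (s : nat -> Y) : set (nat -> Y) :=
  [set t | gromov_asymptotic t t /\ gromov_asymptotic s t].

Definition gromov_boundary : set (set (nat -> Y)) :=
  [set boundary_point s | s in [set s | gromov_asymptotic s s]].

Variables (G : groupType) (act : G -> Y -> Y).

Definition isometric_action : Prop :=
  [/\ forall x, act 1%g x = x,
      forall g h x, act (g * h)%g x = act g (act h x) &
      forall g x y, mdist (act g x) (act g y) = mdist x y].

Definition acylindrical : Prop :=
  forall eps : R, 0 < eps ->
    exists (r : R) (N : nat), [/\ 0 < r, (0 < N)%N &
      forall x y : Y, r <= mdist x y ->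
        [set g : G | mdist x (act g x) <= eps /\ mdist y (act g y) <= eps]
          #<= `I_N].

(* The orbit map z |-> g^z y is a quasi-isometric embedding of the integers; for
   an isometric action this does not depend on y, and asking for some y rather
   than all y rules out an empty space. *)
Definition loxodromic (g : G) : Prop :=
  exists (y : Y) (L C : R), [/\ 1 <= L, 0 <= C &
    forall i j : int,
      L^-1 * `|i - j|%:~R - C <= mdist (act (expgz g i) y) (act (expgz g j) y)
        <= L * `|i - j|%:~R + C].

Definition boundary_act (g : G) (xi : set (nat -> Y)) : set (nat -> Y) :=
  [set act g \o s | s in xi].

Definition boundary_fix (g : G) : set (set (nat -> Y)) :=
  [set xi | gromov_boundary xi /\ boundary_act g xi = xi].

Definition non_elementary : Prop :=
  exists g h : G, [/\ loxodromic g, loxodromic h &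
    boundary_fix g `&` boundary_fix h = set0].

End MetricGeometry.

Definition acylindrically_hyperbolic (R : realType) (G : groupType) : Prop :=
  exists (Y : metricType R) (act : G -> Y -> Y),
    [/\ geodesic_space Y, gromov_hyperbolic Y &
        [/\ isometric_action act, acylindrical act & non_elementary act]].

(* Main.v *)
Require Import Defs.
From HB Require Import structures.
From mathcomp Require Import all_boot all_order all_algebra.
From mathcomp Require Import all_classical all_reals all_analysis.
From mathcomp Require Import zify ring lra.
Set Implicit Arguments.
Unset Strict Implicit.
Unset Printing Implicit Defensive.
Import Order.TTheory GRing.Theory Num.Theory.

(* H_sigma, n >= 4, is the amalgam of the chain groups A = <a_0, a_1, a_2> and
   B = <a_2, ..., a_(n-1), a_0> over the free group C on a_0 and a_2, and each chain
   group is an iterated amalgam of Baumslag-Solitar groups over infinite cyclic groups.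
   A suitable conjugate g of a_2 by a power of a_1 satisfies that C and g C g^-1 meet
   inside <a_2>, and some g' in B similarly meets C inside <a_0>; since these two cyclic
   groups have trivial intersection, a segment s of length 4 of the Bass-Serre tree has a
   trivial fixator. The action on that tree need not be acylindrical. Instead, join
   two vertices of the tree by an edge whenever the geodesic between them contains no
   translate of s. Up to bounded error the resulting graph metric is additive along
   geodesics of the tree, so the graph is hyperbolic, and elements moving two far away
   points a little are determined, up to boundedly many choices, by the image of one
   translate of s, so the action on the graph is acylindrical. *)

(** * Graph metrics and trees *)

(** The conjugates come from affine maps. Let a Baumslag-Solitar group act on the rational line, its
    generator b as the translation by 1 and a as the homothety of ratio k / m: then a^e b a^-e is
    the translation by (k / m)^e. Since |m| and |k| differ, e = 1 or e = -1 makes this a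
    non-integer, so no product b^i (a^e b a^-e) b^j is a power of a; normal forms then push the
    intersection of C with its conjugate into a cyclic group. With at least four generators both
    chain groups have at least three, which makes their end generators free. The length 4 comes from
    a word Y X Y X with X in A and Y in B. Three consecutive edges of its path have a middle edge
    whose fixator is squeezed at one end into a conjugate of the powers of a_0 and at the other into
    the same conjugate of the powers of a_2; the word Y X alone has only two edges. With g the
    inverse of Y X Y X and s = [o, g o], translates of s tile the axis of g, and each one adds at
    least 1 to the graph metric, so g is loxodromic. The second loxodromic element is the conjugate
    of g by a_1, which fixes o; its axis leaves o through other edges than that of g. *)

Section GraphMetric.
Variables (V : Type) (e : V -> V -> Prop).

Fixpoint chain (n : nat) (x y : V) : Prop :=
  if n is n'.+1 then exists2 z, e x z & chain n' z y else x = y.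

Hypothesis e_sym : forall x y, e x y -> e y x.
Hypothesis e_conn : forall x y, exists n, chain n x y.

Lemma chain_cat m n x y z : chain m x y -> chain n y z -> chain (m + n) x z.
Proof.
elim: m x => [|m IHm] x /= => [->//|[t xt ty] yz].
by exists t => //; exact: IHm.
Qed.

Lemma chain1 x y : e x y -> chain 1 x y.
Proof. by exists y. Qed.

Lemma chain_sym n x y : chain n x y -> chain n y x.
Proof.
elim: n x => [|n IHn] x /= => [->//|[t xt ty]].
by have := chain_cat (IHn _ ty) (chain1 (e_sym xt)); rewrite addn1.
Qed.

Lemma gdist_ex x y : exists n, `[< chain n x y >].
Proof. by have [n xy] := e_conn x y; exists n; apply/asboolP. Qed.

Definition gdist (x y : V) : nat := ex_minn (gdist_ex x y).

Lemma gdist_chain x y : chain (gdist x y) x y.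
Proof. by rewrite /gdist; case: ex_minnP => n /asboolP. Qed.

Lemma gdist_le n x y : chain n x y -> (gdist x y <= n)%N.
Proof. by rewrite /gdist; case: ex_minnP => m _ h xy; apply: h; exact/asboolP. Qed.

Lemma gdistxx x : gdist x x = 0%N.
Proof. by apply/eqP; rewrite -leqn0; exact: gdist_le. Qed.

Lemma gdist_eq0 x y : gdist x y = 0%N -> x = y.
Proof. by move=> xy; have := gdist_chain x y; rewrite xy. Qed.

Lemma gdistC x y : gdist x y = gdist y x.
Proof.
by apply/eqP; rewrite eqn_leq; apply/andP; split; apply: gdist_le;
  apply: chain_sym; exact: gdist_chain.
Qed.

Lemma gdist_tri y x z : (gdist x z <= gdist x y + gdist y z)%N.
Proof. by apply: gdist_le; apply: chain_cat; exact: gdist_chain. Qed.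

Lemma gdist_edge x y : e x y -> (gdist x y <= 1)%N.
Proof. by move=> xy; exact/gdist_le/chain1. Qed.

Lemma gdist_step x y n : gdist x y = n.+1 ->
  exists2 z, e x z & gdist z y = n.
Proof.
move=> xy; have := gdist_chain x y; rewrite xy => -[z xz zy].
exists z => //; have := gdist_le zy; have := gdist_tri z x y.
have := gdist_edge xz; lia.
Qed.

Lemma gdist_homo (f : V -> V) :
  (forall x y, e x y -> e (f x) (f y)) ->
  forall x y, (gdist (f x) (f y) <= gdist x y)%N.
Proof.
move=> fe x y; apply: gdist_le.
move: (gdist x y) (gdist_chain x y) => n; elim: n x => [|n IHn] x /=.
  by move=> ->.
by move=> [z xz zy]; exists (f z); [exact: fe|exact: IHn].
Qed.

End GraphMetric.

Section TreeMetric.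
Variables (V : Type) (d : V -> V -> nat).

(* d may vanish on distinct points: the points at distance 0 from each other
   are the vertices of the tree. *)
Record tree_metric : Prop := TreeMetric {
  tree_refl : forall x, d x x = 0%N;
  tree_sym : forall x y, d x y = d y x;
  tree_four : forall x y z w,
    (d x y + d z w <= maxn (d x z + d y w) (d x w + d y z))%N;
  tree_step : forall x y, (0 < d x y)%N ->
    exists2 z, d x z = (d x y).-1 & d z y = 1%N;
  tree_even : forall x y z, ~~ odd (d x y + d y z + d x z) }.

Hypothesis dT : tree_metric.

Definition btw (x z y : V) : Prop := (d x z + d z y)%N = d x y.

Let dC := tree_sym dT.
Let d0 := tree_refl dT.

Lemma tree_tri z x y : (d x y <= d x z + d z y)%N.
Proof. by have := tree_four dT x y z z; rewrite d0 (dC z y); lia. Qed.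

Lemma btw_sym x z y : btw x z y -> btw y z x.
Proof. by rewrite /btw (dC y z) (dC z x) (dC y x); lia. Qed.

Lemma btwl x y : btw x x y. Proof. by rewrite /btw d0. Qed.
Lemma btwr x y : btw x y y. Proof. by rewrite /btw d0 addn0. Qed.

Lemma btw_between x a b y : btw x a y -> btw a b y -> btw x b y /\ btw x a b.
Proof.
rewrite /btw => xay aby.
have := tree_tri a x b; have := tree_tri b x y; split; lia.
Qed.

Lemma btw_betweenl x a b y : btw x b y -> btw x a b -> btw x a y /\ btw a b y.
Proof.
rewrite /btw => xby xab.
have := tree_tri b a y; have := tree_tri a x y; split; lia.
Qed.

(** Removing m separates u from w, and v cannot be on both sides. In terms of distances this is the
    four point condition for u, w, m, v. *)
Lemma tree_sep m u v w : btw u m w -> btw u m v \/ btw v m w.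
Proof.
rewrite /btw => umw; have := tree_four dT u w m v.
have := tree_tri m u v; have := tree_tri m v w.
rewrite (dC w m) (dC w v) (dC m v).
case: (eqVneq (d u m + d v m) (d u v))%N => [?|?]; first by left.
case: (eqVneq (d v m + d m w) (d v w))%N => [?|?]; first by right.
lia.
Qed.

Lemma btw_total x a b y : btw x a y -> btw x b y -> (d x a <= d x b)%N ->
  btw x a b /\ btw a b y.
Proof.
rewrite /btw => xay xby ab; have := tree_four dT x y a b.
have := tree_tri b a y; have := tree_tri a x b; have := tree_tri b a x.
rewrite (dC a x) (dC b x) (dC y a) (dC y b); split; lia.
Qed.

Lemma btw_uniq x a b y : btw x a y -> btw x b y -> d x a = d x b -> d a b = 0%N.
Proof.
move=> xay xby ab; have [|+ _] := btw_total xay xby; first by rewrite ab.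
by rewrite /btw ab; lia.
Qed.

(** Local geodesics of a tree are geodesics. The overlap [b, c] needs positive length, as otherwise
    the path could turn back at b. *)
Lemma btw_concat a b c e : btw a b c -> btw b c e -> (0 < d b c)%N ->
  btw a b e /\ btw a c e.
Proof.
rewrite /btw => abc bce bc; have := tree_four dT a c b e.
have := tree_tri b a e; have := tree_tri c a e; rewrite (dC c b).
split; lia.
Qed.

Lemma tree_point x y k : (k <= d x y)%N -> exists2 z, btw x z y & d x z = k.
Proof.
move: {2}(d x y) (leqnn (d x y)) => n; elim: n y => [|n IHn] y xyn kxy.
  by exists x; [exact: btwl|rewrite d0; lia].
have [->|kxy'] := eqVneq k (d x y); first by exists y; [exact: btwr|].
have [t xt ty] := @tree_step dT x y ltac:(lia).
have [|| z xzt xz] := IHn t; [lia|lia|exists z => //].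
have xty : btw x t y by rewrite /btw; lia.
by have [] := btw_betweenl xty xzt.
Qed.

Lemma tree_median x y z : exists m, [/\ btw x m y, btw y m z & btw x m z].
Proof.
have e2 := tree_even dT x y z; rewrite (dC y z) (dC x z) in e2.
have t1 := tree_tri z x y; have t2 := tree_tri y z x; have t3 := tree_tri x z y.
rewrite (dC x z) in t1; rewrite (dC y x) in t2.
(* The Gromov product of x and y at z; parity makes it an integer, so the median is a vertex. *)
pose k := ((d z x + d z y - d x y)./2)%N.
have k2 : (k + k + d x y = d z x + d z y)%N by rewrite /k; lia.
have [m zmx zm] := @tree_point z x k ltac:(lia).
have := tree_four dT m y z x; have := tree_tri m z y; have := tree_tri m x y.
have := (dC m x, dC m y, dC m z, dC x y, dC x z, dC y z).
by move=> [[[[[]]]]] *; exists m; move: zmx; rewrite /btw; split; lia.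
Qed.

End TreeMetric.

(** * The graph of free segments of a tree *)

Section TreeAction.
Variables (G : groupType) (V : Type) (act : G -> V -> V) (d : V -> V -> nat).
Hypothesis dT : tree_metric d.
Hypothesis act1 : forall x, act 1%g x = x.
Hypothesis actM : forall g h x, act (g * h)%g x = act g (act h x).
Hypothesis actd : forall g x y, d (act g x) (act g y) = d x y.
Variables s0 s1 : V.
Hypothesis s_gt1 : (1 < d s0 s1)%N.
Hypothesis s_fix : forall g, d (act g s0) s0 = 0%N -> d (act g s1) s1 = 0%N ->
  g = 1%g.

Notation btw := (btw d).
Notation sigma := (d s0 s1).
Let dC := tree_sym dT.
Let d0 := tree_refl dT.
Let tri := tree_tri dT.

Definition seg (u v : V) : Prop := exists g,
  (u = act g s0 /\ v = act g s1) \/ (u = act g s1 /\ v = act g s0).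

(* A translate of [s0, s1], in either direction, lies on the geodesic [x, y]. *)
Definition copy (x y : V) : Prop := exists u v,
  seg u v /\ (d x u + d u v + d v y)%N = d x y.

Definition free (x y : V) : Prop := ~ copy x y.

Lemma seg_sym u v : seg u v -> seg v u.
Proof. by case=> g h; exists g; case: h => -[-> ->]; [right|left]. Qed.

Lemma seg_act g u v : seg u v -> seg (act g u) (act g v).
Proof.
by case=> k h; exists (g * k)%g; rewrite !actM; case: h => -[-> ->]; [left|right].
Qed.

Lemma seg_len u v : seg u v -> d u v = sigma.
Proof. by case=> g [] [-> ->]; rewrite actd // dC. Qed.

Lemma copy_sym x y : copy x y -> copy y x.
Proof.
case=> u [v [uv h]]; exists v, u; split; first exact: seg_sym.
by rewrite (dC y v) (dC v u) (dC u x) (dC y x); lia.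
Qed.

Lemma copy_act g x y : copy x y -> copy (act g x) (act g y).
Proof.
case=> u [v [uv h]]; exists (act g u), (act g v); split; first exact: seg_act.
by rewrite !actd.
Qed.

Lemma copy_len x y : copy x y -> (sigma <= d x y)%N.
Proof. by case=> u [v [/seg_len uv h]]; lia. Qed.

Lemma copy_sub x x' y' y : (d x x' + d x' y' + d y' y)%N = d x y ->
  copy x' y' -> copy x y.
Proof.
move=> h [u [v [uv h']]]; exists u, v; split => //.
by have := tri x' x u; have := tri y' v y; have := tri u x y;
  have := tri v u y; lia.
Qed.

Lemma free_sym x y : free x y -> free y x.
Proof. by move=> xy /copy_sym. Qed.

Lemma free_act g x y : free x y -> free (act g x) (act g y).
Proof.
move=> xy /(copy_act (g^-1)%g); rewrite -!actM mulVg !act1; exact: xy.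
Qed.

(** The place where [s_gt1] enters: the new graph contains the edges of the tree, hence is
    connected. *)
Lemma free_short x y : (d x y <= 1)%N -> free x y.
Proof. by move=> xy /copy_len; lia. Qed.

Lemma free_conn x y : exists n, chain free n x y.
Proof.
move: {2}(d x y) (erefl (d x y)) => n; elim: n y => [|n IHn] y xy.
  by exists 1%N, y => //; apply: free_short; rewrite xy.
have [|z xz zy] := tree_step dT (x := x) (y := y); first by rewrite xy.
have [|k xzk] := IHn z; first by rewrite xz xy.
exists (k + 1)%N; apply: chain_cat xzk _; apply: chain1; apply: free_short.
by rewrite zy.
Qed.

Definition freedist := gdist free_conn.
Notation N := freedist.

Lemma freedistC x y : N x y = N y x. Proof. exact/gdistC/free_sym. Qed.
Let NC := freedistC.
Let Ntri y x z : (N x z <= N x y + N y z)%N. Proof. exact: gdist_tri. Qed.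

Lemma freedist_act g x y : N (act g x) (act g y) = N x y.
Proof.
apply/eqP; rewrite eqn_leq; apply/andP; split.
  by apply: gdist_homo => *; exact: free_act.
rewrite -{1}[x]act1 -{1}[y]act1 -(mulVg g) !actM.
by apply: gdist_homo => *; exact: free_act.
Qed.

Lemma freedist_free x y : free x y -> (N x y <= 1)%N.
Proof. exact: gdist_edge. Qed.

(* Removing m cuts the tree, so a chain from one side to the other has a step whose
   geodesic passes through m. *)
Lemma chain_sep n x y m : chain free n.+1 x y -> btw x m y ->
  exists i u v, [/\ (i <= n)%N, chain free i x u, free u v,
    chain free (n - i) v y & btw u m v].
Proof.
elim: n x => [|n IHn] x.
  by move=> [z xz /= zy] xmy; exists 0%N, x, z; rewrite zy in xz *.
move=> [z xz zy] xmy; have [xmz|zmy] := tree_sep dT z xmy.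
  by exists 0%N, x, z.
have [i [u [v [ilen zu uv vy umv]]]] := IHn _ zy zmy.
by exists i.+1, u, v; split => //; exists z.
Qed.

Lemma freedist_sep x y m : (0 < N x y)%N -> btw x m y ->
  exists u v, [/\ (N x u + N v y < N x y)%N, free u v, btw u m v
    & N x u = 0%N -> u = x].
Proof.
move=> xy xmy; have c : chain free (N x y).-1.+1 x y.
  by rewrite prednK //; exact: gdist_chain.
have [i [u [v [ilen xu uv vy umv]]]] := chain_sep c xmy.
exists u, v; split => //; last by move=> h; rewrite (gdist_eq0 h).
have := gdist_le free_conn xu; have := gdist_le free_conn vy.
by rewrite -/N; lia.
Qed.

Lemma free_btw u m v : free u v -> btw u m v -> free u m /\ free m v.
Proof.
by move=> uv umv; split=> /copy_sub h; apply: uv; apply: h;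
  rewrite d0 ?addn0 ?add0n.
Qed.

(** Some step [u, v] of a shortest chain passes over m; the parts [u, m] and [m, v] of a free
    segment are free, so going through m costs a bounded amount. With the triangle inequality this
    makes [N] additive along tree geodesics up to 2. *)
Lemma freedist_btw x m y : btw x m y -> (N x m + N m y <= N x y + 2)%N.
Proof.
move=> xmy; have [xy|xy] := posnP (N x y).
  have xy0 : d x y = 0%N by rewrite (gdist_eq0 xy).
  have xm := @freedist_free x m; have my := @freedist_free m y.
  rewrite /btw xy0 in xmy; have := xm (free_short _); have := my (free_short _).
  by lia.
have [u [v [h uv umv _]]] := freedist_sep xy xmy.
have [um mv] := free_btw uv umv.
have := freedist_free um; have := freedist_free mv.
have := Ntri u x m; have := Ntri v m y; lia.
Qed.

(** The step passing over m cannot start at x, because [x, m] contains a copy and is not free. So at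
    least one step comes before it, and this pays for the detour through m. *)
Lemma freedist_copy x m y : copy x m -> btw x m y -> (N m y < N x y)%N.
Proof.
move=> xm xmy; have sm := copy_len xm.
have [xy|xy] := posnP (N x y); first have {}xy := gdist_eq0 xy.
  by move: xmy; rewrite /btw xy d0; move: sm; rewrite xy; lia.
have [u [v [h uv umv u0]]] := freedist_sep xy xmy.
have [um mv] := free_btw uv umv.
have mvN := freedist_free mv; have := Ntri v m y.
have [xu|xu] := posnP (N x u); last by lia.
by have := u0 xu => xu'; rewrite xu' in um.
Qed.

(** A discrete intermediate value argument: [N x] changes by at most 1 along an edge of the tree. *)
Lemma freedist_point x y K : (K <= N x y)%N -> exists2 m, btw x m y & N x m = K.
Proof.
move: {2}(d x y) (erefl (d x y)) => n; elim: n y => [|n IHn] y xy Kxy.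
  have := @freedist_free x y (free_short _); rewrite xy => /(_ isT) xy1.
  have [K0|K0] := posnP K.
    by exists x; [exact: (btwl dT)|rewrite K0; exact: gdistxx].
  by exists y; [exact: (btwr dT)|lia].
have [->|Kxy'] := eqVneq K (N x y); first by exists y; [exact: (btwr dT)|].
have [|z xz zy] := tree_step dT (x := x) (y := y); first by rewrite xy.
have := @freedist_free z y (free_short _); rewrite zy => /(_ isT) zy1.
have [||m xmz xm] := IHn z; [by rewrite xz xy|by have := Ntri z x y; lia|].
exists m => //; have xzy : btw x z y by rewrite /btw; lia.
by have [] := btw_betweenl dT xzy xmz.
Qed.

Lemma freedist_four o x y z :
  (N x z + N o y <= maxn (N x y + N o z) (N y z + N o x) + 10)%N.
Proof.
have [m1 [ox1 x1y oy1]] := tree_median dT o x y.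
have [m2 [oy2 y2z oz2]] := tree_median dT o y z.
have [m3 [ox3 x3z oz3]] := tree_median dT o x z.
have := tree_four dT x z o y.
(* In the tree, m3 is at least as far from o as m1 or m2, and this passes to [N] with error 2. The
   constant 10 is three times 2 for cutting two geodesics at m3 and one at the chosen median, plus
   twice this error. *)
have m13 : (N o m1 <= N o m3 + 2)%N \/ (N o m2 <= N o m3 + 2)%N.
  have [le13|lt31] := leqP (d o m1) (d o m3).
    left; have [om13 _] := btw_total dT ox1 ox3 le13.
    by have := freedist_btw om13; lia.
  right; have [|om23 _] := btw_total dT oz2 oz3; last first.
    by have := freedist_btw om23; lia.
  have := tree_four dT x z y o; move: ox1 x1y oy1 oy2 y2z oz2 ox3 x3z oz3 lt31.
  rewrite /btw; have := (dC m1 x, dC m1 y, dC m2 y, dC m2 z, dC m3 x, dC m3 z).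
  have := (dC o x, dC o y, dC o z, dC x y, dC x z, dC y z).
  by move=> [[[[[]]]]] ? ? ? ? ? ? [[[[[]]]]] *; lia.
move=> _; have := freedist_btw x1y; have := freedist_btw y2z.
have := freedist_btw ox3; have := freedist_btw oz3.
have := Ntri m1 o x; have := Ntri m1 o y; have := Ntri m2 o y; have := Ntri m2 o z.
have := Ntri m3 x z.
have := (NC m1 x, NC m1 y, NC m2 y, NC m2 z, NC m3 x, NC m3 z).
have := (NC o x, NC o y, NC o z, NC x y, NC x z, NC y z).
by move=> [[[[[]]]]] ? ? ? ? ? ? [[[[[]]]]] *; lia.
Qed.

(** If g z left [x, y], it would separate x from g x or y from g y, and [freedist_btw] would make
    that displacement exceed E; the margin 2 absorbs the error. *)
Lemma act_deep E x y z g : btw x z y -> (E + 2 < N x z)%N -> (E + 2 < N z y)%N ->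
  (N x (act g x) <= E)%N -> (N y (act g y) <= E)%N -> btw x (act g z) y.
Proof.
move=> xzy xz zy gx gy.
have gxzy : btw (act g x) (act g z) (act g y) by rewrite /btw !actd.
have [h|h] := tree_sep dT x gxzy.
  by have := freedist_btw h; rewrite freedist_act (NC (act g x) x); lia.
have [//|{}h] := tree_sep dT y h.
by have := freedist_btw h; rewrite freedist_act; lia.
Qed.

Lemma btw_dist x y a b : btw x a y -> btw x b y -> (d x a <= d x b)%N ->
  (d x a + d a b = d x b)%N /\ (d a b + d b y = d a y)%N.
Proof. by move=> xay xby ab; exact: btw_total. Qed.

Lemma seg_inj u v g h : seg u v ->
  d (act g u) (act h u) = 0%N -> d (act g v) (act h v) = 0%N -> g = h.
Proof.
move=> [k uvk] gu gv; suff gh : (g^-1 * h = 1)%g.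
  by rewrite -[h](mulVKg g) gh mulg1.
have key w : d (act g w) (act h w) = 0%N -> d (act (g^-1 * h)%g w) w = 0%N.
  by rewrite -(actd (g^-1)%g) -!actM mulVg act1 dC.
have {}gu := key _ gu; have {}gv := key _ gv.
have key2 w : d (act (g^-1 * h)%g (act k w)) (act k w) = 0%N ->
    d (act (k^-1 * (g^-1 * h) * k)%g w) w = 0%N.
  by rewrite -(actd (k^-1)%g) -!actM mulVg act1.
have e : (k^-1 * (g^-1 * h) * k)%g = 1%g.
  by case: uvk gu gv => -[-> ->] /key2 gu /key2 gv; exact: s_fix.
by apply/eqP; rewrite -(conjg_eq1 _ k) conjgE mulgA e.
Qed.

(* Fix a copy [u, v] deep inside [x, y]. An element g moving x and y by at most E
   maps it into [x, y], and is determined by the positions of g u and g v since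
   [s0, s1] has a trivial fixator. When two such positions of g u agree modulo sigma
   and lie in the same direction but differ, a whole copy separates them, so N (g u) y
   tells them apart; and this number takes at most 2 E + 1 values. *)
Lemma freedist_acyl (E : nat) : exists R M : nat, forall x y, (R <= N x y)%N ->
  exists f : G -> nat, (forall g, (N x (act g x) <= E)%N ->
    (N y (act g y) <= E)%N -> (f g < M)%N) /\
  (forall g h, (N x (act g x) <= E)%N -> (N y (act g y) <= E)%N ->
    (N x (act h x) <= E)%N -> (N y (act h y) <= E)%N -> f g = f h -> g = h).
Proof.
exists (2 * E + 20)%N, (sigma * ((2 * E + 1) * 2))%N => x y Rxy.
(* The constants keep [m1, m2] at [N]-distance more than E + 2 from x and from y. Free pairs are at
   distance at most 1, so distance 2 forces a copy between m1 and m2. *)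
have [m1 xm1y xm1] := @freedist_point x y (E + 5) ltac:(lia).
have m1y : (E + 15 <= N m1 y)%N by have := Ntri m1 x y; lia.
have [m2 m1m2y m1m2] := @freedist_point m1 y 2 ltac:(lia).
have m2y : (E + 13 <= N m2 y)%N by have := Ntri m2 m1 y; lia.
have [u [v [uv uvm]]] : copy m1 m2.
  by apply: contrapT => /freedist_free; rewrite m1m2.
have [xm1m2 xm2y] := btw_between dT xm1y m1m2y.
have m1um2 : btw m1 u m2.
  by move: uvm; rewrite /btw; have := tri v u m2; have := tri u m1 m2; lia.
have m1vm2 : btw m1 v m2.
  by move: uvm; rewrite /btw; have := tri u m1 v; have := tri v m1 m2; lia.
have deep w : btw m1 w m2 -> [/\ btw x w y, (E + 2 < N x w)%N & (E + 2 < N w y)%N].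
  move=> m1w; have [xm1y' _] := btw_betweenl dT m1m2y m1w.
  have [m1wy wm2y] := btw_betweenl dT m1m2y m1w.
  have [xwy xm1w] := btw_between dT xm1y m1wy.
  by have := freedist_btw wm2y; have := freedist_btw xm1w; split => //; lia.
have [xuy xu uy] := deep u m1um2; have [xvy xv vy] := deep v m1vm2.
have su := seg_len uv.
pose b g := (d x (act g u) < d x (act g v))%N.
(* [q] shifts N (g u) y into the range from 0 to 2 E. The second half of [qE] ensures that the
   truncated subtraction loses nothing. *)
pose q g := (N (act g u) y - (N u y - E))%N.
(* A mixed-radix code with digits below sigma, 2 E + 1 and 2, so that equal codes have equal
   digits. *)
exists (fun g => (d x (act g u) %% sigma + sigma * (q g + (2 * E + 1) * b g))%N).
have qE g : (N x (act g x) <= E)%N -> (N y (act g y) <= E)%N -> (q g < 2 * E + 1)%N /\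
    (N u y <= N (act g u) y + E)%N.
  move=> gx gy; have := Ntri (act g y) (act g u) y; have := Ntri y (act g u) (act g y).
  by rewrite freedist_act (NC (act g y)) /q; lia.
have sg0 : (0 < sigma)%N by lia.
split=> [g gx gy|g h gx gy hx hy e].
  have [qg _] := qE g gx gy; have := ltn_pmod (d x (act g u)) sg0.
  by case: (b g) => /=; nia.
have [qg ug] := qE g gx gy; have [qh uh] := qE h hx hy.
have em : (d x (act g u) %% sigma = d x (act h u) %% sigma)%N.
  have := congr1 (modn^~ sigma) e.
  by rewrite /= ![(_ + sigma * _)%N]addnC ![(sigma * _)%N]mulnC !modnMDl !modn_mod.
have {}e : (q g + (2 * E + 1) * b g = q h + (2 * E + 1) * b h)%N.
  by apply/eqP; rewrite -(eqn_pmul2l sg0); apply/eqP; move: e; rewrite em; lia.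
have bb : b g = b h by case: (b g) (b h) e => [] []; rewrite ?muln1 ?muln0; lia.
have qq : N (act g u) y = N (act h u) y by move: e; rewrite bb /q; lia.
have := act_deep xuy xu uy gx gy; have := act_deep xuy xu uy hx hy.
have := act_deep xvy xv vy gx gy; have := act_deep xvy xv vy hx hy.
wlog : g h {gx gy hx hy e qg ug qh uh} em bb qq / (d x (act g u) <= d x (act h u))%N.
  move=> W; have [|/ltnW] := leqP (d x (act g u)) (d x (act h u)); first exact: W.
  by move=> le hv gv hu gu; apply/esym; apply: W.
move=> le hv gv hu gu.
have lg : d (act g u) (act g v) = sigma by rewrite actd.
have lh : d (act h u) (act h v) = sigma by rewrite actd.
have posn a c : btw x a y -> btw x c y -> d a c = sigma ->
    (d x c = if d x a < d x c then d x a + sigma else d x a - sigma)%N.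
  move=> xa xc ac; case: ltnP => ac'; first by have [] := btw_dist xa xc (ltnW ac'); lia.
  by have [] := btw_dist xc xa ac'; rewrite (dC c a); lia.
have pg := posn _ _ gu gv lg; have ph := posn _ _ hu hv lh.
rewrite -/(b g) in pg; rewrite -/(b h) -bb in ph.
have [eu|neu] := eqVneq (d x (act g u)) (d x (act h u)).
  apply: (seg_inj uv); first exact: (btw_uniq dT gu hu eu).
  by apply: (btw_uniq dT gv hv); rewrite pg ph eu.
have far : (d x (act g u) + sigma <= d x (act h u))%N.
  move/eqP: em; rewrite eq_sym eqn_mod_dvd // => /dvdn_leq h'.
  by have := h' ltac:(lia); lia.
have [hle hby] := btw_dist gu hu le.
suff /freedist_copy - /(_ _ hby) : copy (act g u) (act h u) by rewrite qq ltnn.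
case: (b g) pg ph => pg ph.
  exists (act g u), (act g v); split; first exact: seg_act.
  have [] := btw_dist gv hu ltac:(lia); rewrite d0 lg; lia.
exists (act h v), (act h u); split; first exact/seg_sym/seg_act.
have [+ _] := btw_dist gu hv ltac:(lia); have [+ _] := btw_dist hv hu ltac:(lia).
by rewrite d0 (dC (act h v) (act h u)) lh; lia.
Qed.

Lemma btw_act g x y z : btw x y z -> btw (act g x) (act g y) (act g z).
Proof. by rewrite /btw !actd. Qed.

Section Axis.
Variables (o : V) (g : G).
Hypothesis go : btw (act (g^-1)%g o) o (act g o).
Hypothesis gc : copy o (act g o).

Let dgo : (0 < d o (act g o))%N. Proof. by have := copy_len gc; lia. Qed.

Lemma axis_btw n : btw o (act g o) (act (g ^+ n.+1)%g o).
Proof.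
elim: n => [|n IHn]; first by rewrite expg1; exact: (btwr dT).
have h1 : btw o (act g o) (act (g * g)%g o).
  by have := btw_act g go; rewrite -!actM mulgV act1.
have h2 : btw (act g o) (act (g * g)%g o) (act (g ^+ n.+2)%g o).
  by have := btw_act g IHn; rewrite -!actM -expgS.
by have [|//] := btw_concat dT h1 h2; rewrite actM actd.
Qed.

(** Every period of the axis starts with a copy, and [freedist_copy] gains 1 for each. *)
Lemma axis_lower n : (n <= N o (act (g ^+ n)%g o))%N.
Proof.
elim: n => [//|n IHn]; have := freedist_copy gc (axis_btw n).
by rewrite expgS actM freedist_act; exact: leq_ltn_trans.
Qed.

Lemma axis_upper n : (N o (act (g ^+ n)%g o) <= n * N o (act g o))%N.
Proof.
elim: n => [|n IHn]; first by rewrite act1 leqn0; apply/eqP; exact: gdistxx.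
apply: leq_trans (Ntri (act g o) _ _) _.
by rewrite expgS actM freedist_act mulSn leq_add2l; exact: IHn.
Qed.

(* When z projects to o on the axis of g, the geodesic from z to g z passes through o,
   so z and g z do not approach a common boundary point. *)
Lemma axis_off z : btw z o (act g o) -> btw z o (act (g^-1)%g o) ->
  (N z o + N o (act g z) <= N z (act g z) + 2)%N.
Proof.
move=> zgo zVo; apply: freedist_btw.
have h : btw o (act g o) (act g z).
  by apply: (btw_sym dT); have := btw_act g zVo; rewrite -!actM mulgV act1.
by have [] := btw_concat dT zgo h dgo.
Qed.

End Axis.

(** At o, no branch contains one of p, p' together with one of q, q'. So if z shares a branch with p
    or p', it shares none with q or q'. *)
Lemma axes_off z o p p' q q' : btw p o q -> btw p o q' -> btw p' o q -> btw p' o q' ->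
  (btw z o p /\ btw z o p') \/ (btw z o q /\ btw z o q').
Proof.
move=> pq pq' p'q p'q'.
have h a b : btw a o b -> btw z o a \/ btw z o b.
  by move=> ab; have [/(btw_sym dT)|] := tree_sep dT z ab; [left|right].
by have := h _ _ pq; have := h _ _ pq'; have := h _ _ p'q; have := h _ _ p'q'; tauto.
Qed.

End TreeAction.

(** * Amalgams and their Bass-Serre trees *)

(** Makes a letterwise action descend to the presented group. The predicate [P] singles out the
    states on which inverse letters cancel, such as the valid normal forms below. *)
Lemma pres_eq_fold (X : choiceType) (rels : set (word X * word X)) (S : Type)
    (P : S -> Prop) (f : X * bool -> S -> S) :
  (forall l s, P s -> P (f l s)) ->
  (forall l s, P s -> f l (f (invl l) s) = s) ->
  (forall u v, rels (u, v) -> forall s, P s -> foldr f s u = foldr f s v) ->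
  forall u v, pres_eq rels u v -> forall s, P s -> foldr f s u = foldr f s v.
Proof.
move=> fP fK frel u v.
have wP w s : P s -> P (foldr f s w) by move=> sP; elim: w => //= l w; exact: fP.
elim=> {u v} //.
- by move=> u v _ IH s sP; rewrite IH.
- by move=> u v w _ IH1 _ IH2 s sP; rewrite IH1 ?IH2.
- by move=> u u' v v' _ IH1 _ IH2 s sP; rewrite !foldr_cat IH2 // IH1 //; exact: wP.
Qed.

(** * Trees given by prefix-closed families of sequences *)

Section ListTree.
Variables (T : eqType) (V : Type) (code : V -> seq T).

Fixpoint lcp (s t : seq T) : nat :=
  match s, t with
  | x :: s', y :: t' => if x == y then (lcp s' t').+1 else 0
  | _, _ => 0
  end.

Lemma lcpC s t : lcp s t = lcp t s.
Proof. by elim: s t => [|x s IH] [|y t] //=; rewrite eq_sym IH. Qed.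

Lemma lcp_le s t : (lcp s t <= size s)%N.
Proof. by elim: s t => [|x s IH] [|y t] //=; case: ifP => // _; exact: IH. Qed.

(** The ultrametric inequality from which the four point condition follows. *)
Lemma lcp_tri t s u : (minn (lcp s t) (lcp t u) <= lcp s u)%N.
Proof.
elim: s t u => [|x s IH] [|y t] [|z u] //=; rewrite ?min0n ?minn0 //.
case: (eqVneq x y) => [->|xy]; last by rewrite min0n.
by case: (eqVneq y z) => [_|yz]; rewrite ?minn0 // minnSS; exact: IH.
Qed.

Lemma lcp_take s k : lcp (take k s) s = minn k (size s).
Proof. by elim: s k => [|x s IH] [|k] //=; rewrite eqxx IH minnSS. Qed.

Lemma lcp_full s t : lcp s t = size s -> take (size s) t = s.
Proof.
by elim: s t => [|x s IH] [|y t] //=; case: eqP => // -> [/IH ->].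
Qed.

Definition listd (v w : V) : nat :=
  (size (code v) + size (code w) - 2 * lcp (code v) (code w))%N.

Hypothesis closed : forall v k, exists w, code w = take k (code v).

Lemma listd0 v w : listd v w = 0%N -> code v = code w.
Proof.
rewrite /listd; have := lcp_le (code v) (code w); have := lcp_le (code w) (code v).
rewrite lcpC => h1 h2 h3.
have /lcp_full : lcp (code v) (code w) = size (code v) by lia.
by rewrite take_oversize //; lia.
Qed.

Lemma listd1 v w : listd v w = 1%N -> exists l,
  code v = rcons (code w) l \/ code w = rcons (code v) l.
Proof.
have key s t : lcp s t = size s -> size t = (size s).+1 -> exists l, t = rcons s l.
  move=> /lcp_full st sz; case/lastP: t st sz => [//|t l].
  rewrite size_rcons => st [sz]; exists l; congr rcons.
  by rewrite -st -cats1 -sz take_size_cat.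
rewrite /listd => vw; have h1 := lcp_le (code v) (code w).
have h2 := lcp_le (code w) (code v); rewrite lcpC in h2.
have [le|lt] := leqP (size (code v)) (size (code w)).
  by have [||l] := key (code v) (code w); [lia|lia|exists l; right].
by have [||l] := key (code w) (code v); [rewrite lcpC; lia|lia|exists l; left].
Qed.

Lemma listd_tree : tree_metric listd.
Proof.
split=> [v|v w|x y z w|x y|x y z].
- have := lcp_take (code v) (size (code v)); rewrite take_size minnn /listd => ->.
  by rewrite mul2n -addnn subnn.
- by rewrite /listd lcpC addnC.
- rewrite /listd; set cx := code x; set cy := code y; set cz := code z; set cw := code w.
  have key : (minn (lcp cx cz + lcp cy cw) (lcp cx cw + lcp cy cz) <= lcp cx cy + lcp cz cw)%N.
    have := lcp_tri cz cx cy; have := lcp_tri cw cx cy.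
    have := lcp_tri cx cz cw; have := lcp_tri cy cz cw.
    by rewrite !(lcpC cz) !(lcpC cw); lia.
  have le u v : (2 * lcp u v <= size u + size v)%N.
    by have := lcp_le u v; have := lcp_le v u; rewrite (lcpC v); lia.
  have := (le cx cy, le cz cw, le cx cz, le cy cw, le cx cw, le cy cz).
  by case=> -[[[[]]]]; lia.
- rewrite /listd => xy; have lex := lcp_le (code x) (code y).
  have ley := lcp_le (code y) (code x); rewrite lcpC in ley.
  (* The last vertex before y is the parent of y, unless y is an ancestor of x; then it is the child
     of y on the way to x. *)
  have [yl|yl] := ltnP (lcp (code x) (code y)) (size (code y)).
    have [z zE] := closed y (size (code y)).-1; exists z; rewrite zE size_take.
      have -> : lcp (code x) (take (size (code y)).-1 (code y)) = lcp (code x) (code y).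
        have := lcp_tri (code y) (code x) (take (size (code y)).-1 (code y)).
        have := lcp_tri (take (size (code y)).-1 (code y)) (code x) (code y).
        have := lcp_le (take (size (code y)).-1 (code y)) (code x).
        rewrite (lcpC (code y) (take _ _)) lcp_take size_take lcpC.
        by case: ifP; lia.
      by case: ifP; lia.
    by rewrite lcp_take; case: ifP; lia.
  have yx : take (size (code y)) (code x) = code y by apply: lcp_full; rewrite lcpC; lia.
  have [z zE] := closed x (size (code y)).+1; exists z; rewrite zE.
    by rewrite lcpC lcp_take size_take; case: ifP; lia.
  have -> : lcp (take (size (code y)).+1 (code x)) (code y) = size (code y).
    rewrite lcpC -{1}yx -(take_takel _ (leqnSn _)) lcp_take size_take.
    by case: ifP; lia.
  by rewrite size_take; case: ifP; lia.
- rewrite /listd; have := (lcp_le (code x) (code y), lcp_le (code y) (code x)).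
  have := (lcp_le (code y) (code z), lcp_le (code z) (code y)).
  have := (lcp_le (code x) (code z), lcp_le (code z) (code x)).
  rewrite (lcpC (code y) (code x)) (lcpC (code z) (code x)) (lcpC (code z) (code y)).
  by do 3! case=> ? ?; lia.
Qed.

End ListTree.

Section Amalgam.
Variables (E : bool -> groupType) (C : groupType) (iota : forall b, C -> E b).
Hypothesis iotaM : forall b, {morph iota b : x y / (x * y)%g}.
Hypothesis iota_inj : forall b, injective (iota b).

Definition inC b (x : E b) : Prop := exists c, x = iota b c.

Let iota1 b : iota b 1%g = 1%g.
Proof. by apply: (@mulgI _ (iota b 1%g)); rewrite -iotaM !mulg1. Qed.

Let iotaV b c : iota b (c^-1)%g = ((iota b c)^-1)%g.
Proof. by apply: (@mulgI _ (iota b c)); rewrite -iotaM !mulgV. Qed.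

(* xget depends only on the set it is given, hence rep only on the coset C x. *)
Definition rep b (x : E b) : E b :=
  if `[< inC x >] then 1%g
  else xget 1%g [set y | exists c, x = (iota b c * y)%g].
Definition cpart b (x : E b) : C := xget 1%g [set c | x = (iota b c * rep x)%g].

Lemma inC_iotaM b c (x : E b) : inC (iota b c * x)%g <-> inC x.
Proof.
split=> -[c' h]; last by exists (c * c')%g; rewrite iotaM h.
by exists (c^-1 * c')%g; rewrite iotaM -h iotaV mulKg.
Qed.

Lemma rep_mul b c (x : E b) : rep (iota b c * x)%g = rep x.
Proof.
rewrite /rep; have -> : `[< inC (iota b c * x)%g >] = `[< inC x >].
  exact/asbool_equiv_eq/inC_iotaM.
case: asboolP => // _; congr xget; apply/seteqP; split=> y [c' /= h].
  by exists (c^-1 * c')%g; rewrite iotaM -mulgA -h iotaV mulKg.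
by exists (c * c')%g; rewrite iotaM h mulgA.
Qed.

Lemma cpart_rep b (x : E b) : x = (iota b (cpart x) * rep x)%g.
Proof.
rewrite /cpart; case: xgetP => [c _ /= <- //|] h.
rewrite /rep in h *; case: asboolP h => [[c xc] h|_ h].
  by case: (h c); rewrite /= mulg1.
exfalso; move: h; case: xgetP => [y _ [c xc] h|h _]; first exact: (h c).
by apply: (h x); exists 1%g; rewrite iota1 mul1g.
Qed.

Lemma rep_rep b (x : E b) : rep (rep x) = rep x.
Proof. by rewrite [in RHS](cpart_rep x) rep_mul. Qed.

Lemma rep_eq1 b (x : E b) : rep x = 1%g <-> inC x.
Proof.
split=> [x1|xC]; last by rewrite /rep; case: asboolP.
by exists (cpart x); rewrite {1}(cpart_rep x) x1 mulg1.
Qed.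

Lemma rep_iota b c : rep (iota b c) = 1%g.
Proof. by apply/rep_eq1; exists c. Qed.

Lemma cpart_mul b c (x : E b) : cpart (iota b c * x)%g = (c * cpart x)%g.
Proof.
apply: (@iota_inj b); apply: (@mulIg _ (rep x)).
by rewrite iotaM -mulgA -cpart_rep -{1}(rep_mul c) -cpart_rep.
Qed.

Lemma cpart_iota b c : cpart (iota b c) = c.
Proof.
by apply: (@iota_inj b); rewrite [RHS](cpart_rep (iota b c)) rep_iota mulg1.
Qed.

Lemma cpart_id b (t : E b) : rep t = t -> cpart t = 1%g.
Proof.
move=> tt; apply: (@iota_inj b); apply: (@mulIg _ t).
by rewrite -{2}tt -cpart_rep iota1 mul1g.
Qed.

Definition letter : choiceType := {b : bool & E b}.
Definition mkl b (x : E b) : letter := Tagged E x.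

Definition cast b (l : letter) : option (E b) :=
  match tag l =P b with
  | ReflectT e => Some (eq_rect _ E (tagged l) _ e)
  | ReflectF _ => None
  end.

Lemma cast_mkl b (x : E b) : cast b (mkl x) = Some x.
Proof. by rewrite /cast; case: eqP => // e; rewrite (eq_irrelevance e erefl). Qed.

Lemma cast_neq b (l : letter) : tag l != b -> cast b l = None.
Proof. by rewrite /cast; case: eqP. Qed.

(** Rewrites a normal form as an element of E b followed by letters that do not start in E b. Since
    [join] inverts this on valid forms, E b acts by plain multiplication on the first component. *)
Definition split b (w : C * seq letter) : E b * seq letter :=
  if w.2 is l :: s then
    if cast b l is Some t then ((iota b w.1 * t)%g, s) else (iota b w.1, w.2)
  else (iota b w.1, w.2).
Definition join b (y : E b) (s : seq letter) : C * seq letter :=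
  (cpart y, if rep y == 1%g then s else mkl (rep y) :: s).
Definition lact b (x : E b) (w : C * seq letter) : C * seq letter :=
  join (x * (split b w).1)%g (split b w).2.

Fixpoint alt (b : bool) (s : seq letter) : Prop :=
  if s is l :: s' then
    [/\ tag l = b, rep (tagged l) = tagged l, tagged l <> 1%g & alt (~~ b) s']
  else True.

Definition valid (w : C * seq letter) : Prop := exists b, alt b w.2.

Lemma split_alt b c s : alt (~~ b) s -> split b (c, s) = (iota b c, s).
Proof.
by case: s => [//|l s [lb _ _ _]]; rewrite /split /= cast_neq // lb; case: (b).
Qed.

Lemma split_joinK b (y : E b) s : alt (~~ b) s ->
  split b (join y s) = (y, s).
Proof.
move=> sb; rewrite /join; case: eqP => [y1|y1].
  by rewrite split_alt // [in RHS](cpart_rep y) y1 mulg1.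
by rewrite /split /= cast_mkl -cpart_rep.
Qed.

Lemma join_alt b (y : E b) s : alt (~~ b) s -> valid (join y s).
Proof.
move=> sb; rewrite /join /valid /=; case: eqP => y1; first by exists (~~ b).
by exists b; split => //=; exact: rep_rep.
Qed.

Lemma split_valid b w : valid w ->
  alt (~~ b) (split b w).2 /\ join (split b w).1 (split b w).2 = w.
Proof.
case: w => c [|[b' t] s] [b'' /=].
  by rewrite /split /= /join rep_iota eqxx cpart_iota.
case=> /= <- tt t1 sb {b''}; have [e|nb] := eqVneq b' b.
  subst b'; rewrite /split /= -[existT _ _ _]/(mkl t) cast_mkl /=; split => //.
  by rewrite /join rep_mul tt cpart_mul cpart_id // mulg1; case: eqP.
rewrite /split /= cast_neq //=; split; last by rewrite /join rep_iota eqxx cpart_iota.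
have e : b' = ~~ b by case: (b) (b') nb => [] [].
by subst b'.
Qed.

Lemma lact_valid b (x : E b) w : valid w -> valid (lact x w).
Proof. by move=> /(split_valid b)[h _]; exact: join_alt. Qed.

Lemma split_lact b (x : E b) w : valid w ->
  split b (lact x w) = ((x * (split b w).1)%g, (split b w).2).
Proof. by move=> /(split_valid b)[h _]; rewrite /lact split_joinK. Qed.

Lemma lactM b (x y : E b) w : valid w -> lact (x * y)%g w = lact x (lact y w).
Proof. by move=> vw; rewrite {2}/lact split_lact //= mulgA. Qed.

Lemma lact1 b w : valid w -> lact (1 : E b)%g w = w.
Proof. by move=> /(split_valid b)[_ h]; rewrite /lact mul1g. Qed.

Lemma lact_iota b c w : valid w -> lact (iota b c) w = ((c * w.1)%g, w.2).
Proof.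
move=> /(split_valid b)[_ wE].
by rewrite -[in RHS]wE /lact /join rep_mul cpart_mul.
Qed.

(** All elements of both factors are generators and the multiplication tables are relations, so the
    factors may be arbitrary groups. *)
Definition arels : set (word letter * word letter) :=
  [set uv | (exists b (x y : E b),
      uv = ([:: (mkl x, false); (mkl y, false)], [:: (mkl (x * y)%g, false)])) \/
    exists c, uv = ([:: (mkl (iota true c), false)], [:: (mkl (iota false c), false)])].

Definition amalgam : groupType := presented arels.
Definition inj b (x : E b) : amalgam := pres_gen arels (mkl x).

Lemma injM b (x y : E b) : inj (x * y)%g = (inj x * inj y)%g.
Proof.
have := @pres_rels _ arels [:: (mkl x, false); (mkl y, false)] [:: (mkl (x * y)%g, false)].
by rewrite /= /evall /= !mulg1 => -> //; left; exists b, x, y.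
Qed.

Lemma inj_iota b b' c : inj (iota b c) = inj (iota b' c).
Proof.
have h : inj (iota true c) = inj (iota false c).
  have := @pres_rels _ arels [:: (mkl (iota true c), false)] [:: (mkl (iota false c), false)].
  by rewrite /= /evall /= !mulg1; apply; right; exists c.
by case: b b' => [] [].
Qed.

Lemma inj1 b : inj (1 : E b)%g = 1%g.
Proof. by apply: (@mulgI _ (inj (1 : E b)%g)); rewrite -injM !mulg1. Qed.

Lemma injV b (x : E b) : inj (x^-1)%g = ((inj x)^-1)%g.
Proof. by apply: (@mulgI _ (inj x)); rewrite -injM !mulgV inj1. Qed.

Lemma amalgam_univ (H : groupType) (f : forall b, E b -> H) :
  (forall b, {morph f b : x y / (x * y)%g}) ->
  (forall c, f true (iota true c) = f false (iota false c)) ->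
  exists h : amalgam -> H, {morph h : x y / (x * y)%g} /\
    forall b (x : E b), h (inj x) = f b x.
Proof.
move=> fM fC; have [|h [[hM hgen] _]] := @pres_univ _ arels H (fun l => f (tag l) (tagged l)).
  move=> u v [[b [x [y [-> ->]]]]|[c [-> ->]]]; rewrite /= /evall /= !mulg1 //.
  by rewrite fM.
by exists h; split => // b x; rewrite hgen.
Qed.

Definition prodl (s : seq letter) : amalgam :=
  foldr (fun l p => (inj (tagged l) * p)%g) 1%g s.

Lemma prodl_cat s t : prodl (s ++ t) = (prodl s * prodl t)%g.
Proof. by elim: s => [|l s /= ->]; rewrite ?mul1g ?mulgA. Qed.

Lemma prodl_surj (p : amalgam) : exists s, p = prodl s.
Proof.
rewrite -(pres_classK p) -pres_evalw; elim: (repr p) => [|[l s] w [s' ws']] /=.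
  by exists [::].
rewrite ws'; case: l => b x; exists (mkl (if s then x^-1 else x)%g :: s').
by rewrite /evall /=; case: s; rewrite ?injV.
Qed.

Definition wact (l : letter * bool) (w : C * seq letter) : C * seq letter :=
  lact (if l.2 then (tagged l.1)^-1 else tagged l.1)%g w.

Let wact_eq u v : pres_eq arels u v -> forall w, valid w ->
  foldr wact w u = foldr wact w v.
Proof.
apply: pres_eq_fold => [[l s] w|[l s] w vw|{}u {}v].
- exact: lact_valid.
- by rewrite /wact /= -lactM //; case: s; rewrite /= ?mulVg ?mulgV lact1.
case=> [[b [x [y [-> ->]]]]|[c [-> ->]]] w vw; rewrite /wact /=.
  by rewrite lactM.
by rewrite !lact_iota.
Qed.

(** Van der Waerden's method: the amalgam acts on the valid normal forms, and p is sent to the image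
    of the trivial one. Uniqueness of normal forms is built in. *)
Definition nf (p : amalgam) : C * seq letter := foldr wact (1%g, [::]) (repr p).

Let valid1 : valid (1%g, [::]). Proof. by exists true. Qed.

Lemma nf1 : nf 1%g = (1%g, [::]).
Proof. exact: (wact_eq (pres_repr arels [::]) valid1). Qed.

Lemma nf_valid p : valid (nf p).
Proof. by rewrite /nf; elim: (repr p) => //= l w; exact: lact_valid. Qed.

Lemma nf_mul b (x : E b) p : nf (inj x * p)%g = lact x (nf p).
Proof.
have -> : (inj x * p)%g = pres_class arels ((mkl x, false) :: repr p).
  by rewrite -pres_evalw /= pres_evalw pres_classK.
exact: (wact_eq (pres_repr arels _) valid1).
Qed.

Definition nfprod (w : C * seq letter) : amalgam :=
  (inj (iota true w.1) * prodl w.2)%g.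

Lemma nfprod_join b (y : E b) s : nfprod (join y s) = (inj y * prodl s)%g.
Proof.
rewrite /nfprod /join /= (inj_iota true b) [in RHS](cpart_rep y) injM.
by case: eqP => [->|_]; rewrite ?inj1 ?mulg1 //= mulgA.
Qed.

Lemma nfK p : nfprod (nf p) = p.
Proof.
have [s ->] := prodl_surj p; elim: s => [|[b x] s IHs].
  by rewrite nf1 /nfprod /= iota1 inj1 mulg1.
rewrite [prodl _]/= nf_mul; have [_ h] := split_valid b (nf_valid (prodl s)).
rewrite -{1}h nfprod_join in IHs.
by rewrite /lact nfprod_join injM -mulgA IHs.
Qed.

Lemma nf_inj p q : nf p = nf q -> p = q.
Proof. by move=> pq; rewrite -(nfK p) pq nfK. Qed.

(** The element x can be read off from the action of [inj x] on the trivial normal form. *)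
Lemma inj_inj b : injective (@inj b).
Proof.
move=> x y xy; have := congr1 (fun p => (split b (nf (p * 1)%g)).1) xy.
by rewrite /= !nf_mul nf1 !split_lact //= iota1 !mulg1.
Qed.

Fixpoint reduced (b : bool) (s : seq letter) : Prop :=
  if s is l :: s' then [/\ tag l = b, ~ inC (tagged l) & reduced (~~ b) s'] else True.

Lemma reduced_cat b s t :
  reduced b s -> reduced (b (+) odd (size s)) t -> reduced b (s ++ t).
Proof.
elim: s b => [|l s IHs] b /=; first by rewrite addbF.
case=> lb lC sb tb; split => //; apply: IHs => //.
by move: tb; rewrite addbN addNb.
Qed.

(** Choosing coset representatives alters letters but not tags, because a letter outside C stays
    outside C after multiplication by an element of C. Hence the tags of a reduced word depend only
    on its product. *)
Lemma nf_reduced b s : reduced b s ->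
  alt b (nf (prodl s)).2 /\ map tag (nf (prodl s)).2 = map tag s.
Proof.
elim: s b => [|[b' x] s IHs] b /=; first by rewrite nf1.
case=> /= e; subst b => xC /IHs; rewrite nf_mul /lact; case: (nf (prodl s)) => c l /= [lb le].
rewrite split_alt // /join /=.
have y1 : rep (x * iota b' c)%g != 1%g.
  apply/eqP => /rep_eq1 [c' h]; apply: xC; exists (c' * c^-1)%g.
  by rewrite iotaM -h iotaV mulgK.
rewrite (negbTE y1) /= le; split => //; split => //; first exact: rep_rep.
exact/eqP.
Qed.

Lemma reduced_inj b b' s (x : E b') : reduced b s -> prodl s = inj x ->
  s = [::] \/ size s = 1%N /\ b = b'.
Proof.
move=> /[dup] sr /nf_reduced [_ sE] sx; move: sE.
have -> : nf (prodl s) = lact x (1%g, [::]) by rewrite -nf1 -nf_mul mulg1 sx.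
rewrite /lact /split /= /join; case: ifP => _ /=; first by case: (s); [left|].
by case: s sr {sx} => [|l [|]] //= [<- _ _] [<-]; right.
Qed.

Lemma reduced_tags b b' s s' : reduced b s -> reduced b' s' -> prodl s = prodl s' ->
  map tag s = map tag s'.
Proof. by move=> /nf_reduced[_ <-] /nf_reduced[_ <-] ->. Qed.

Definition strip b (p : amalgam) : seq letter := (split b (nf p)).2.

Fixpoint pad (b : bool) (s : seq letter) : seq (option letter) :=
  if s is l :: s' then Some l :: pad (~~ b) s' else if b then [::] else [:: None].

(* The vertex (b, p) is the coset E_b p. Its code is the path to it from the coset
   E_true, the edges being labelled by their representatives; the label None
   stands for the edge joining the cosets E_true and E_false. *)
Definition vertex : Type := (bool * amalgam)%type.
Definition code (v : vertex) : seq (option letter) := rev (pad v.1 (strip v.1 v.2)).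

Lemma pad_inj b b' s s' : pad b s = pad b' s' -> b = b' /\ s = s'.
Proof.
elim: s b b' s' => [|l s IHs] b b' [|l' s'] /=; try by case: b; case: b'.
by case=> -> /IHs[/negb_inj -> ->].
Qed.

Lemma code_coset b (x : E b) p : code (b, (inj x * p)%g) = code (b, p).
Proof. by rewrite /code /strip /= nf_mul split_lact //; exact: nf_valid. Qed.

Lemma strip_nf b p : exists x : E b, nf (inj x * p)%g = (1%g, strip b p).
Proof.
exists ((split b (nf p)).1^-1)%g; have vp := nf_valid p.
have [h1 h2] := split_valid b vp.
rewrite nf_mul /lact mulVg -/(strip b p) /join.
have r1 : rep (1 : E b)%g = 1%g by rewrite -(iota1 b) rep_iota.
by rewrite r1 eqxx -(iota1 b) cpart_iota.
Qed.

Lemma code_inj b b' p q : code (b, p) = code (b', q) ->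
  b = b' /\ exists x : E b, q = (inj x * p)%g.
Proof.
move=> /(can_inj revK) /pad_inj /= [<- pq]; split => //.
have [x xp] := strip_nf b p; have [y yq] := strip_nf b q.
have e : (inj y * q = inj x * p)%g by apply: nf_inj; rewrite xp yq pq.
by exists (y^-1 * x)%g; rewrite injM injV -mulgA -e mulKg.
Qed.

(** If the normal form of p starts with a letter of E b', the coset of E b' absorbs this letter and
    the other coset keeps it, so one code extends the other by it. If there is no letter, the
    difference is the edge [None]. *)
Lemma code_flip b p : exists l,
  code (b, p) = rcons (code (~~ b, p)) l \/ code (~~ b, p) = rcons (code (b, p)) l.
Proof.
have [b' pb] := nf_valid p; rewrite /code /strip /=.
have h s : alt b' s -> s = (nf p).2 -> strip (~~ b') p = s /\ strip b' p = behead s.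
  rewrite /strip; case: (nf p) => c l0 sb /= sE; subst l0; case: s sb => [|l s] /=.
    by rewrite /split.
  case=> lb _ _ sb; rewrite /split /= cast_neq; last by rewrite lb; case: (b').
  split => //; case: l lb => /= b0 x e; subst b0.
  by rewrite -[existT _ _ _]/(mkl x) cast_mkl.
have [e1 e2] := h _ pb erefl; rewrite /strip in e1 e2.
have hh : exists l, rev (pad (~~ b') (split (~~ b') (nf p)).2) =
    rcons (rev (pad b' (split b' (nf p)).2)) l \/
    rev (pad b' (split b' (nf p)).2) =
    rcons (rev (pad (~~ b') (split (~~ b') (nf p)).2)) l.
  rewrite e1 e2; case: (nf p).2 => [|l s] /=.
    by exists None; case: (b'); [left|right].
  by exists (Some l); left; rewrite negbK rev_cons.
by have [l hl] := hh; exists l; move: hl; case: (b) (b') => [] [] /= []; tauto.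
Qed.

Lemma code_parent b p s l : code (b, p) = rcons s l -> exists q,
  code (b, q) = code (b, p) /\ code (~~ b, q) = s.
Proof.
have [x xp] := strip_nf b p; move=> pE; exists (inj x * p)%g.
rewrite code_coset; split => //; have [vp _] := split_valid b (nf_valid p).
move: pE; rewrite /code {2}/strip /= xp -/(strip b p).
rewrite -/(strip b p) in vp; case: (strip b p) vp => [|[b' t] s'] /=.
  case: (b) => /= _ sE; first by case: (s) sE.
  by have /rcons_inj[<- _] : rcons [::] None = rcons s l by exact: sE.
case=> /= e _ _ _; subst b'; rewrite rev_cons => /rcons_inj[<- _].
by rewrite /split /= -[existT _ _ _]/(mkl t) cast_mkl.
Qed.

Lemma code_closed (v : vertex) k : exists w, code w = take k (code v).
Proof.
have [n] : exists n, (size (code v) - k = n)%N by exists (size (code v) - k)%N.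
elim: n v => [|n IHn] [b p] vk; first by exists (b, p); rewrite take_oversize //; lia.
have [s [l vE]] : exists s l, code (b, p) = rcons s l.
  by move: vk; case/lastP: (code (b, p)) => [//|s l] _; exists s, l.
have [q [_ qs]] := code_parent vE; move: vk; rewrite vE size_rcons => vk.
have [|w wE] := IHn (~~ b, q); first by rewrite qs; lia.
exists w; rewrite wE qs -cats1 takel_cat //; lia.
Qed.

Notation d := (listd code).

Lemma vertex_tree : tree_metric d.
Proof. exact/listd_tree/code_closed. Qed.

Let tri := tree_tri vertex_tree.

Lemma listd_rcons v w l : code v = rcons (code w) l -> d v w = 1%N.
Proof.
move=> h; rewrite /listd h lcpC -cats1 size_cat /=.
have -> : lcp (code w) (code w ++ [:: l]) = size (code w).
  have := lcp_take (code w ++ [:: l]) (size (code w)).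
  by rewrite take_size_cat // size_cat => ->; exact/minn_idPl/leq_addr.
by rewrite mul2n -addnn addnAC addKn.
Qed.

Lemma listd_flip b p : d (b, p) (~~ b, p) = 1%N.
Proof.
have [l [h|h]] := code_flip b p; first exact: listd_rcons h.
by rewrite (tree_sym vertex_tree); exact: listd_rcons h.
Qed.

Lemma listd_adj v w : d v w = 1%N -> exists b p,
  (code (b, p) = code v /\ code (~~ b, p) = code w).
Proof.
move=> vw; have [l [h|h]] := listd1 vw => {vw}.
  case: v h => b p h; have [q [e1 e2]] := code_parent h.
  by exists b, q.
case: w h => b p h; have [q [e1 e2]] := code_parent h.
by exists (~~ b), q; rewrite negbK.
Qed.

(** The inverse turns right multiplication on the cosets E_b p into a left action. *)
Definition vact (g : amalgam) (v : vertex) : vertex := (v.1, (v.2 * g^-1)%g).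

(** Right multiplication has no simple effect on codes, but it preserves adjacency: adjacent
    vertices are the two cosets of a common element. The bound follows edge by edge along a
    geodesic. *)
Lemma vact_le g v w : (d (vact g v) (vact g w) <= d v w)%N.
Proof.
have d0 v' w' : code v' = code w' -> code (vact g v') = code (vact g w').
  case: v' w' => [b p] [b' q] /code_inj[<- [x ->]].
  by rewrite /vact /= -mulgA code_coset.
have dd x y x' y' : code x = code x' -> code y = code y' -> d x y = d x' y'.
  by rewrite /listd => -> ->.
have [n] : exists n, d v w = n by exists (d v w).
elim: n w => [|n IHn] w vw.
  by rewrite (dd _ _ _ _ (d0 _ _ (listd0 vw)) erefl) (tree_refl vertex_tree).
have [|z vz zw] := tree_step vertex_tree (x := v) (y := w); first by rewrite vw.
rewrite vw in vz; have IH := IHn z vz.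
have [b [p [/d0 pz /d0 pw]]] := listd_adj zw.
have : d (vact g z) (vact g w) = 1%N.
  by rewrite -(dd _ _ _ _ pz pw) /vact /= listd_flip.
by have := tri (vact g z) (vact g v) (vact g w); lia.
Qed.

Lemma vact1 v : vact 1%g v = v.
Proof. by case: v => b p; rewrite /vact /= invg1 mulg1. Qed.

Lemma vactM g h v : vact (g * h)%g v = vact g (vact h v).
Proof. by rewrite /vact /= invgM mulgA. Qed.

Lemma vactd g v w : d (vact g v) (vact g w) = d v w.
Proof.
apply/eqP; rewrite eqn_leq vact_le /=.
by rewrite -{1}[v]vact1 -{1}[w]vact1 -(mulVg g) !vactM vact_le.
Qed.

Lemma listd_coset b b' p q : d (b, p) (b', q) = 0%N ->
  b = b' /\ exists x : E b, q = (inj x * p)%g.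
Proof. by move=> h; exact: code_inj (listd0 h). Qed.

Lemma listd_coset0 b (x : E b) p : d (b, (inj x * p)%g) (b, p) = 0%N.
Proof.
have := tree_refl vertex_tree (b, p); rewrite /listd code_coset //.
Qed.

(* The distance from E_true to E_true p for p a reduced product with these tags. *)
Definition tag_dist (ts : seq bool) : nat :=
  let t := if ts is true :: ts' then ts' else ts in (size t + odd (size t))%N.

(** A first letter in E_true is absorbed by the coset. Each other letter is an edge on the way to
    the root, and a last letter in E_false, which occurs exactly in odd length, adds the edge
    [None]. *)
Lemma listd_reduced b s p q : reduced b s -> (p * q^-1)%g = prodl s ->
  d (true, p) (true, q) = tag_dist (map tag s).
Proof.
move=> /nf_reduced[sb sE] pq.
have -> : d (true, p) (true, q) = d (true, prodl s) (true, 1%g).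
  rewrite -(vactd q) /vact /= mulgV pq //.
have c1 : code (true, 1%g) = [::] by rewrite /code /strip /= nf1.
rewrite /listd c1 lcpC /= addn0 subn0 /code /strip size_rev -sE.
have size_pad c t : size (pad c t) = (size t + (odd (size t) (+) ~~ c))%N.
  elim: t c => [|l t IHt] c /=; first by case: c.
  by rewrite IHt negbK addSn; case: (odd _); case: c.
rewrite size_pad /= addbF; case: (nf (prodl s)) => c [|[[] x] t] //=; rewrite /split /=.
  by rewrite -[existT _ _ _]/(mkl x) cast_mkl /tag_dist /= size_map.
by rewrite cast_neq // /tag_dist /= size_map.
Qed.

End Amalgam.

Local Open Scope classical_set_scope.
Local Open Scope ring_scope.

(** * Geometric realization of a graph *)

Record pseudo_distance (R : realType) (T : Type) := PseudoDistance {
  pdist :> T -> T -> R;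
  pdistxx : forall x, pdist x x = 0;
  pdistC : forall x y, pdist x y = pdist y x;
  pdist_tri : forall y x z, pdist x z <= pdist x y + pdist y z }.

Section MetricQuotient.
Variables (R : realType) (T : Type) (D : pseudo_distance R T).

(* The class of p is encoded by the function D p. *)
Definition mquot : Type := {classic {f : T -> R | exists p, f = D p}}.
HB.instance Definition _ := Choice.on mquot.

Definition mclass (p : T) : mquot := exist _ (D p) (ex_intro _ p erefl).
Definition mrepr (y : mquot) : T := sval (cid (svalP y)).

Lemma pdist_eq0 p q : D p q = 0 -> D p = D q :> (T -> R).
Proof.
move=> pq; apply/funext => z; apply/eqP; rewrite eq_le.
have := pdist_tri D q p z; have := pdist_tri D p q z; rewrite (pdistC D q p) pq.
by rewrite !add0r => -> ->.
Qed.

Lemma mclass_eq p q : D p q = 0 -> mclass p = mclass q.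
Proof. by move=> /pdist_eq0 pq; exact: eq_exist. Qed.

Lemma mreprK : cancel mrepr mclass.
Proof.
move=> [f hf]; rewrite /mrepr; case: cid => p /= fp.
by apply: eq_exist; rewrite fp.
Qed.

Let mq (x y : mquot) : R := D (mrepr x) (mrepr y).

Lemma mclass_repr p : D (mrepr (mclass p)) = D p :> (T -> R).
Proof. by rewrite /mrepr; case: cid => q /= ->. Qed.

Let mqE p q : mq (mclass p) (mclass q) = D p q.
Proof. by rewrite /mq mclass_repr pdistC mclass_repr pdistC. Qed.

Let mqxx x : mq x x = 0. Proof. exact: pdistxx. Qed.
Let mqC x y : mq x y = mq y x. Proof. exact: pdistC. Qed.
Let mq_tri y x z : mq x z <= mq x y + mq y z. Proof. exact: pdist_tri. Qed.
Let mq_pos x y : mq x y = 0 -> x = y.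
Proof. by move=> /mclass_eq; rewrite !mreprK. Qed.

HB.instance Definition _ := isMetric.Build R mquot mqxx mq_pos mqC mq_tri.

Lemma mdist_class p q : mdist (mclass p) (mclass q) = D p q.
Proof. exact: mqE. Qed.

End MetricQuotient.

Section Geodesics.
Variables (R : realType) (Y : metricType R).

Definition joined (x y : Y) : Prop := exists c : R -> Y,
  [/\ c 0 = x, c (mdist x y) = y &
    forall s t : R, s \in `[0, mdist x y] -> t \in `[0, mdist x y] ->
      mdist (c s) (c t) = `|s - t|].

(** The Lipschitz bounds on the pieces before, between and after two parameters add up to the
    distance of the end points, so the triangle inequality leaves no slack. *)
Lemma joined_lip (x y : Y) (c : R -> Y) : c 0 = x -> c (mdist x y) = y ->
  (forall s t : R, 0 <= s -> s <= t -> t <= mdist x y ->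
    mdist (c s) (c t) <= t - s) -> joined x y.
Proof.
move=> cx cy lip; exists c; split=> // s t.
have h a b : 0 <= a -> a <= b -> b <= mdist x y -> mdist (c a) (c b) = b - a.
  move=> a0 ab by_; apply/eqP; rewrite eq_le lip //=.
  have := lip 0 a (lexx _) a0 (le_trans ab by_).
  have := lip b (mdist x y) (le_trans a0 ab) by_ (lexx _).
  have := metric_triangle x (c a) y; have := metric_triangle (c a) (c b) y.
  by rewrite cx cy; lra.
rewrite !in_itv /= => /andP[s0 sy] /andP[t0 ty].
have [st|ts] := leP s t; first by rewrite h // distrC ger0_norm ?subr_ge0.
by rewrite metric_sym h ?(ltW ts) // ger0_norm ?subr_ge0 ?(ltW ts).
Qed.

Lemma joined_sym (x y : Y) : joined x y -> joined y x.
Proof.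
move=> [c [cx cy ciso]]; apply: (@joined_lip _ _ (fun s => c (mdist x y - s))).
- by rewrite subr0.
- by rewrite metric_sym subrr.
move=> s t s0 st; rewrite metric_sym => tx.
rewrite ciso ?in_itv /=; try by apply/andP; split; lra.
by rewrite ger0_norm; lra.
Qed.

Lemma joined_concat (x y z : Y) : joined x y -> joined y z ->
  mdist x y + mdist y z = mdist x z -> joined x z.
Proof.
move=> [c [cx cy ciso]] [c' [cy' cz ciso']] xyz.
have D1 := mdist_ge0 x y; have D2 := mdist_ge0 y z.
pose f s := if s <= mdist x y then c s else c' (s - mdist x y).
have fy s : 0 <= s -> s <= mdist x y -> mdist (f s) y = mdist x y - s.
  move=> s0 sx; rewrite /f sx -{1}cy ciso ?in_itv /= ?s0 ?sx ?lexx ?D1 //.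
  by rewrite distrC ger0_norm; lra.
have yf t : mdist x y < t -> t <= mdist x z -> mdist y (f t) = t - mdist x y.
  move=> tx tz; rewrite /f leNgt tx /= -{1}cy' ciso' ?in_itv /=;
    try by apply/andP; split; lra.
  by rewrite distrC subr0 ger0_norm; lra.
apply: (@joined_lip _ _ f).
- by rewrite /f D1.
- rewrite /f -xyz; case: ifPn => [h|_]; last by rewrite addrC addKr.
  have yz : mdist y z = 0 by lra.
  by rewrite yz addr0 cy; exact: mdist_positivity.
move=> s t s0 st tz; have [tx|tx] := leP t (mdist x y).
  rewrite /f tx (le_trans st tx) ciso ?in_itv /=; try by apply/andP; split; lra.
  by rewrite distrC ger0_norm; lra.
have [sx|sx] := leP s (mdist x y).
  apply: le_trans (metric_triangle _ y _) _; rewrite fy // yf //; lra.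
rewrite /f !leNgt tx sx /= ciso' ?in_itv /=; try by apply/andP; split; lra.
by rewrite distrC ger0_norm; lra.
Qed.

End Geodesics.

Record graph_metric (V : Type) (N : V -> V -> nat) : Prop := GraphMetric {
  graph_refl : forall x, N x x = 0%N;
  graph_eq0 : forall x y, N x y = 0%N -> x = y;
  graph_sym : forall x y, N x y = N y x;
  graph_tri : forall y x z, (N x z <= N x y + N y z)%N;
  graph_step : forall x y n, N x y = n.+1 ->
    exists z, (N x z <= 1)%N /\ N z y = n }.

Section Realization.
Variables (R : realType) (V : Type) (N : V -> V -> nat).
Hypothesis NG : graph_metric N.
Let N0 := graph_refl NG.
Let NC := graph_sym NG.
Let Ntri := graph_tri NG.

(* (u, v, t) is the point at distance t from u on the edge from u to v; t is
   clamped to [0, 1], and v is replaced by u when there is no such edge. *)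
Definition epoint : Type := V * V * R.

Definition eend (p : epoint) (a : bool) : V :=
  if a && (N p.1.1 p.1.2 <= 1)%N then p.1.2 else p.1.1.
Definition clamp (t : R) : R := Num.max 0 (Num.min 1 t).
Definition elen (p : epoint) (a : bool) : R :=
  if a then 1 - clamp p.2 else clamp p.2.

Lemma clampP t : 0 <= clamp t /\ clamp t <= 1.
Proof. by rewrite /clamp le_max lexx ge_max ge_min lexx ler01. Qed.

Lemma clamp_id t : 0 <= t -> t <= 1 -> clamp t = t.
Proof.
by rewrite /clamp => t0 t1; rewrite (min_idPr t1) (max_idPr t0).
Qed.

Lemma clamp_lip s t : s <= t -> `|clamp s - clamp t| <= t - s.
Proof.
move=> st; rewrite /clamp !maxEle !minEle ler_norml.
by case: (leP 1 s) => ?; case: (leP 1 t) => ?; rewrite ?ler01;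
  try (case: (leP 0 s) => ?); try (case: (leP 0 t) => ?); apply/andP; split; lra.
Qed.

Lemma eend_le p a b : (N (eend p a) (eend p b) <= 1)%N.
Proof. 
rewrite /eend; case uv : (N p.1.1 p.1.2 <= 1)%N.
  by case: a b => [] []; rewrite /= ?N0 // NC.
by rewrite !andbF N0.
Qed.

Lemma elen_ge0 p a : 0 <= elen p a.
Proof. by have [] := clampP p.2; rewrite /elen; case: a => *; lra. Qed.

Lemma elenN p : elen p true = 1 - elen p false. Proof. by []. Qed.

(** Lengths of the paths through chosen ends, or inside an edge shared by p and q, where [c] tells
    whether q runs along it in the opposite direction. When the two ends coincide both values of [c]
    apply, which folds the edge into a segment of length one half attached to that vertex. *)
Inductive route (p q : epoint) : R -> Prop :=
| route_ends a b : route p q (elen p a + (N (eend p a) (eend q b))%:R + elen q b)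
| route_edge c : (forall x, eend q x = eend p (x (+) c)) ->
    route p q `|elen p false - elen q c|.

Lemma route_sym p q r : route p q r -> route q p r.
Proof.
case=> [a b|c h]; first by rewrite addrC addrA addrAC NC; exact: route_ends.
have -> : `|elen p false - elen q c| = `|elen q false - elen p c|.
  by case: {h}c; [congr `|_|; rewrite !elenN; lra|rewrite distrC].
by apply: route_edge => x; rewrite h addbK.
Qed.

Lemma route_ends_edge p q s a b c : (forall x, eend s x = eend q (x (+) c)) ->
  exists2 r, route p s r &
    r <= elen p a + (N (eend p a) (eend q b))%:R + elen q b + `|elen q false - elen s c|.
Proof.
move=> h; exists (elen p a + (N (eend p a) (eend s (b (+) c)))%:R + elen s (b (+) c)).
  exact: route_ends.
rewrite h addbK -[leRHS]addrA lerD2l.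
have := ler_norm (elen q false - elen s c).
have := ler_norm (elen s c - elen q false); rewrite distrC.
by move: b c {h} => [] [] /=; rewrite ?elenN; lra.
Qed.

Lemma route_tri p q s r1 r2 : route p q r1 -> route q s r2 ->
  exists2 r, route p s r & r <= r1 + r2.
Proof.
case=> [a b|c h].
  case=> [b' c|c h]; last exact: route_ends_edge.
  exists (elen p a + (N (eend p a) (eend s c))%:R + elen s c); first exact: route_ends.
  have t1 := Ntri (eend q b) (eend p a) (eend s c).
  have t2 := Ntri (eend q b') (eend q b) (eend s c).
  (* Entering q by one end and leaving by the other costs the whole length 1 of the edge, which is
     at least the distance of its ends. *)
  have t3 : (N (eend q b) (eend q b'))%:R <= elen q b + elen q b'.
    have [<-|bb'] := eqVneq b b'; first by rewrite N0 addr_ge0 // elen_ge0.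
    apply: (@le_trans _ _ 1); first by rewrite lern1 eend_le.
    by move: b b' bb' {t1 t2} => [] [] //; rewrite ?elenN; lra.
  have t4 := leq_trans t1 (leq_add (leqnn _) t2).
  rewrite -(ler_nat R) !natrD in t4; lra.
case=> [a b|c' h'].
  have h2 x : eend p x = eend q (x (+) c) by rewrite h addbK.
  have [r sr le] := route_ends_edge s b a h2.
  exists r; first exact: route_sym.
  rewrite NC; have -> : `|elen p false - elen q c| = `|elen q false - elen p c|.
    by case: (c); [congr `|_|; rewrite !elenN; lra|rewrite distrC].
  lra.
exists (`|elen p false - elen s (c (+) c')|).
  by apply: route_edge => x; rewrite h' h -addbA (addbC c).
apply: le_trans (ler_distD (elen q c) _ _) _; rewrite lerD2l.
have eN x : elen s (~~ x) = 1 - elen s x by case: x; rewrite ?elenN //= subKr.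
case: (c); rewrite ?addFb ?addTb // eN elenN [leRHS]distrC.
suff -> : 1 - elen q false - (1 - elen s c') = elen s c' - elen q false by [].
by lra.
Qed.

(** There are at most six routes: four choices of ends and two directions along a common edge.
    Without a common edge the default of [f] is another existing route. An attained minimum lets a
    geodesic be cut along a shortest route. *)
Lemma route_min p q : exists2 r, route p q r & forall r', route p q r' -> r <= r'.
Proof.
pose e a b := elen p a + (N (eend p a) (eend q b))%:R + elen q b.
pose f c := if `[< forall x, eend q x = eend p (x (+) c) >]
            then `|elen p false - elen q c| else e true true.
pose s := [:: e false false; e false true; e true false; f false; f true].
exists (\big[Num.min/e true true]_(x <- s) x).
  rewrite !big_cons big_nil.
  have e_ a b : route p q (e a b) by exact: route_ends.
  have f_ c : route p q (f c).
    by rewrite /f; case: asboolP => // h; exact: route_edge.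
  by do 5! (rewrite minEle; case: ifP => // _).
move=> r'; rewrite !big_cons big_nil; case=> [a b|c h].
  by case: a b => [] []; rewrite -/(e _ _) !ge_min lexx ?orbT.
have -> : `|elen p false - elen q c| = f c by rewrite /f; case: asboolP.
by case: {h}c; rewrite !ge_min lexx ?orbT.
Qed.

Definition edist (p q : epoint) : R := sval (cid2 (route_min p q)).

Lemma edist_route p q : route p q (edist p q).
Proof. by rewrite /edist; case: cid2. Qed.

Lemma edist_le p q r : route p q r -> edist p q <= r.
Proof. by rewrite /edist; case: cid2 => /= r0 _ h /h. Qed.

Lemma route_ge0 p q r : route p q r -> 0 <= r.
Proof. by case=> [a b|c _] //; rewrite !addr_ge0 ?elen_ge0. Qed.

Lemma edistxx p : edist p p = 0.
Proof.
apply/eqP; rewrite eq_le (route_ge0 (edist_route _ _)) andbT.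
apply: edist_le; rewrite -[X in route _ _ X](normr0 R) -(subrr (elen p false)).
by apply: (@route_edge p p false) => x; rewrite addbF.
Qed.

Lemma edistC p q : edist p q = edist q p.
Proof. by apply/eqP; rewrite eq_le !edist_le //; exact/route_sym/edist_route. Qed.

Lemma edist_tri q p s : edist p s <= edist p q + edist q s.
Proof.
have [r ps] := route_tri (edist_route p q) (edist_route q s).
exact/le_trans/edist_le.
Qed.

Definition epdist := PseudoDistance edistxx edistC edist_tri.
Definition realization : metricType R := mquot epdist.
Definition epi (p : epoint) : realization := mclass epdist p.

Definition evert (v : V) : epoint := (v, v, 0).

Lemma epi_dist p q : mdist (epi p) (epi q) = edist p q.
Proof. exact: mdist_class. Qed.

Lemma epiP (y : realization) : exists p, y = epi p.
Proof. by exists (mrepr y); rewrite /epi mreprK. Qed.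

Lemma eend_vert v a : eend (evert v) a = v.
Proof. by rewrite /eend; case: ifP. Qed.

Lemma elen_vert v a : elen (evert v) a = a%:R.
Proof. by rewrite /elen clamp_id //; case: a; rewrite ?subr0. Qed.

Lemma edist_vert x y : edist (evert x) (evert y) = (N x y)%:R.
Proof.
apply/eqP; rewrite eq_le; apply/andP; split.
  apply: edist_le; have := route_ends (evert x) (evert y) false false.
  by rewrite !eend_vert !elen_vert addr0 add0r.
have := edist_route (evert x) (evert y); case: _ / => [a b|c /(_ false)].
  by rewrite !eend_vert !elen_vert -!natrD ler_nat; lia.
by rewrite !eend_vert => ->; rewrite N0 normr_ge0.
Qed.

Lemma edist_end p a : edist p (evert (eend p a)) <= elen p a.
Proof.
apply: edist_le; have := route_ends p (evert (eend p a)) a false.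
by rewrite !eend_vert !elen_vert N0 !addr0.
Qed.

Lemma edist_end1 p : edist p (evert (eend p false)) <= 1.
Proof. by apply: le_trans (edist_end _ _) _; have [] := clampP p.2. Qed.

Lemma epi_eq p q : route p q 0 -> epi p = epi q.
Proof.
move=> pq; apply: mclass_eq; apply/eqP; rewrite eq_le edist_le //=.
exact/route_ge0/edist_route.
Qed.

Lemma joined_edge p t : 0 <= t -> t <= 1 ->
  edist p (p.1, t) = `|elen p false - t| -> joined (epi p) (epi (p.1, t)).
Proof.
move=> t0 t1 pt; have [l0 l1] := clampP p.2.
have key (q : epoint) (r : R) : 0 <= r -> r <= 1 ->
    edist q (q.1, r) = `|elen q false - r| -> elen q false <= r ->
    joined (epi q) (epi (q.1, r)).
  move=> r0 r1 qr qler; have [k0 k1] := clampP q.2.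
  have qr' : mdist (epi q) (epi (q.1, r)) = r - elen q false.
    by rewrite epi_dist qr distrC ger0_norm ?subr_ge0.
  apply: (@joined_lip _ _ _ _ (fun s => epi (q.1, elen q false + s))).
  - apply: epi_eq; have := @route_edge (q.1, elen q false + 0) q false.
    rewrite /elen /= addr0 (@clamp_id (clamp _)) // subrr normr0; apply.
    by move=> x; rewrite addbF.
  - by rewrite qr'; congr (epi (_, _)); lra.
  move=> s s' s0 ss' s'r; rewrite epi_dist.
  have := @route_edge (q.1, elen q false + s) (q.1, elen q false + s') false.
  move=> /(_ (fun x => congr1 (eend q) (esym (addbF x)))) /edist_le /le_trans; apply.
  rewrite /elen /=; apply: le_trans (clamp_lip _) _; first by rewrite lerD2l.
  by lra.
have [le|lt] := leP (elen p false) t; first exact: key.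
apply: joined_sym.
have pp : epi p = epi ((p.1, t).1, elen p false).
  apply: epi_eq; have := @route_edge p (p.1, elen p false) false.
  rewrite /elen /= (@clamp_id (clamp _)) // subrr normr0; apply.
  by move=> x; rewrite addbF.
have et : elen (p.1, t) false = t by rewrite /elen /= clamp_id.
rewrite pp; apply: key => //; last by rewrite et ltW.
by rewrite -epi_dist -pp epi_dist edistC pt et distrC.
Qed.

Lemma epi_end p (a : bool) : epi (p.1, a%:R) = epi (evert (eend p a)).
Proof.
apply: epi_eq; have := route_ends (p.1, a%:R) (evert (eend p a)) a false.
rewrite eend_vert elen_vert N0 /elen /= clamp_id ?ler0n ?lern1 ?leq_b1 //.
by case: a; rewrite ?subrr !addr0.
Qed.

Lemma joined_end p (a : bool) : edist p (evert (eend p a)) = elen p a ->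
  joined (epi p) (epi (evert (eend p a))).
Proof.
have [l0 l1] := clampP p.2.
have [a0 a1] : 0 <= (a%:R : R) /\ (a%:R : R) <= 1 by case: (a); rewrite ler01.
move=> h; have := @joined_edge p a%:R a0 a1.
rewrite -(epi_dist p (p.1, a%:R)) (epi_end p a) epi_dist h; apply.
rewrite /elen; case: (a); last by rewrite subr0 ger0_norm.
by rewrite distrC ger0_norm // subr_ge0.
Qed.

Lemma joined_vert x y : joined (epi (evert x)) (epi (evert y)).
Proof.
move: {2}(N x y) (erefl (N x y)) => n; elim: n x => [|n IHn] x xy.
  rewrite (graph_eq0 NG xy); have := @joined_end (evert y) false.
  by rewrite eend_vert; apply; rewrite edistxx elen_vert.
have [z [xz zy]] := graph_step NG xy.
have xz1 : N x z = 1%N by have := Ntri z x y; lia.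
apply: (@joined_concat _ _ _ (epi (evert z))); first last.
- by rewrite !epi_dist !edist_vert zy xy xz1 -natrD add1n.
- exact: IHn.
pose p : epoint := (x, z, 0).
have ex : epi p = epi (evert x) by have := epi_end p false; rewrite /eend.
have ez : epi (p.1, 1) = epi (evert z) by have := epi_end p true; rewrite /eend xz.
have := @joined_edge p 1 ler01 (lexx _).
rewrite -(epi_dist p (p.1, 1)) ez ex epi_dist => h; apply: h.
by rewrite edist_vert xz1 /elen /= clamp_id // sub0r normrN normr1.
Qed.

Lemma realization_geodesic : geodesic_space realization.
Proof.
suff h p q : joined (epi p) (epi q).
  by move=> x y; have [p ->] := epiP x; have [q ->] := epiP y; exact: h.
(* A shortest route consists either of three geodesic pieces whose lengths add up to the distance,
   or of a segment of one edge. *)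
have := erefl (edist p q); have := edist_route p q.
move: {1 3}(edist p q) => r; case=> [a b|c h] pq.
  have p1 := edist_end p a; have q1 := edist_end q b.
  have t1 := edist_tri (evert (eend p a)) p q.
  have t2 := edist_tri (evert (eend q b)) (evert (eend p a)) q.
  have t3 := edist_tri (evert (eend q b)) p q.
  have t4 := edist_tri (evert (eend p a)) p (evert (eend q b)).
  have wq := edistC (evert (eend q b)) q; rewrite !edist_vert in t2 t4.
  apply: (@joined_concat _ _ _ (epi (evert (eend q b)))).
  - apply: (@joined_concat _ _ _ (epi (evert (eend p a)))).
    + by apply: joined_end; lra.
    + exact: joined_vert.
    + by rewrite !epi_dist edist_vert; lra.
  - by apply: joined_sym; apply: joined_end; lra.
  - by rewrite !epi_dist; lra.
have l0 := elen_ge0 q c.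
have eN x : elen q (~~ x) = 1 - elen q x by case: x; rewrite ?elenN //= subKr.
have l1 : elen q c <= 1 by have := elen_ge0 q (~~ c); rewrite eN subr_ge0.
have qE : epi q = epi (p.1, elen q c).
  apply: epi_eq; have := @route_edge q (p.1, elen q c) c.
  have -> : elen q false = elen (p.1, elen q c) c.
    have -> : elen (p.1, elen q c) c = if c then 1 - elen q c else elen q c.
      by rewrite {1}/elen clamp_id.
    by case: (c) => //; rewrite elenN subKr.
  by rewrite subrr normr0; apply=> x; rewrite h addbK.
rewrite qE; apply: joined_edge => //.
by rewrite -epi_dist -qE epi_dist.
Qed.

End Realization.

(** * From trees to acylindrical hyperbolicity *)

Section Powers.
Variables (G : groupType) (g : G).

Lemma expgzS z : expgz g (z + 1) = (expgz g z * g)%g.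
Proof.
case: z => [n|[|n]]; first by rewrite -PoszD addn1 /= expgSr.
  by rewrite /= expg1 mulVg.
have -> : Negz n.+1 + 1 = Negz n by rewrite !NegzE; lia.
by rewrite /= [in RHS]expgS invgM mulgVK.
Qed.

Lemma expgzDn z n : expgz g (z + n%:Z) = (expgz g z * g ^+ n)%g.
Proof.
elim: n => [|n IHn]; first by rewrite addr0 mulg1.
by rewrite -addn1 PoszD addrA expgzS IHn -mulgA -expgSr addn1.
Qed.

Lemma expgzD y z : expgz g (y + z) = (expgz g y * expgz g z)%g.
Proof.
case: z => n; first exact: expgzDn.
by rewrite -[in RHS](subrK n.+1%:Z y) expgzDn NegzE /= mulgK.
Qed.

Lemma expgzN z : expgz g (- z) = ((expgz g z)^-1)%g.
Proof. by apply: (@mulgI _ (expgz g z)); rewrite -expgzD subrr mulgV. Qed.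

End Powers.

Section GraphAction.
Variables (R : realType) (G : groupType) (V : Type).
Variables (act : G -> V -> V) (N : V -> V -> nat).
Hypothesis NG : graph_metric N.
Hypothesis act1 : forall x, act 1%g x = x.
Hypothesis actM : forall g h x, act (g * h)%g x = act g (act h x).
Hypothesis actN : forall g x y, N (act g x) (act g y) = N x y.

Notation Y := (realization R NG).
Notation epi := (epi NG).
Notation edist := (edist N).
Notation vert := (evert R).
Notation base p := (@eend R V N p false).

Definition epact (g : G) (p : epoint R V) : epoint R V :=
  (act g p.1.1, act g p.1.2, p.2).

Lemma eend_act g p a : eend N (epact g p) a = act g (eend N p a).
Proof. by rewrite /eend /= actN; case: ifP. Qed.

Lemma route_act g p q r : route N p q r -> route N (epact g p) (epact g q) r.
Proof.
case=> [a b|c h].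
  by rewrite -(actN g) -!eend_act; exact: (route_ends N (epact g p) (epact g q)).
apply: (@route_edge _ _ N (epact g p) (epact g q) c) => x.
by rewrite !eend_act h.
Qed.

Lemma epact1 p : epact 1%g p = p.
Proof. by case: p => [[u v] t]; rewrite /epact /= !act1. Qed.

Lemma epactM g h p : epact (g * h)%g p = epact g (epact h p).
Proof. by rewrite /epact /= !actM. Qed.

Lemma edist_act g p q : edist (epact g p) (epact g q) = edist p q.
Proof.
have le g' p' q' : edist (epact g' p') (epact g' q') <= edist p' q'.
  by apply: edist_le; apply: route_act; exact: edist_route.
apply/eqP; rewrite eq_le le /=.
by rewrite -{1}[p]epact1 -{1}[q]epact1 -(mulVg g) !epactM.
Qed.

Definition ract (g : G) (y : Y) : Y := epi (epact g (mrepr y)).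

Lemma ract_epi g p : ract g (epi p) = epi (epact g p).
Proof.
apply: mclass_eq => /=; rewrite edist_act -(edistxx N p).
exact: (congr1 (@^~ p) (mclass_repr (epdist R NG) p)).
Qed.

Lemma ract_vert g v : ract g (epi (vert v)) = epi (vert (act g v)).
Proof. by rewrite ract_epi. Qed.

Lemma ract_isometric : isometric_action ract.
Proof.
split=> [x|g h x|g x y]; have [p ->] := epiP x.
- by rewrite ract_epi epact1.
- by rewrite !ract_epi epactM.
- by have [q ->] := epiP y; rewrite !ract_epi !epi_dist edist_act.
Qed.

Lemma mdist_base p q :
  `|mdist (epi p) (epi q) - (N (base p) (base q))%:R| <= 2.
Proof.
rewrite -(edist_vert R NG) epi_dist.
have h1 := edist_end1 NG p; have h2 := edist_end1 NG q.
have := edist_tri NG (vert (base p)) p q; have := edist_tri NG (vert (base q)) (vert (base p)) q.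
have := edist_tri NG p (vert (base p)) (vert (base q)); have := edist_tri NG q p (vert (base q)).
rewrite !(edistC NG (vert _) p) !(edistC NG (vert _) q) => *.
by rewrite ler_norml; apply/andP; split; lra.
Qed.

Lemma mdist_base_le p q : mdist (epi p) (epi q) <= (N (base p) (base q))%:R + 2 /\
  (N (base p) (base q))%:R <= mdist (epi p) (epi q) + 2.
Proof. by have := mdist_base p q; rewrite ler_norml => /andP[? ?]; split; lra. Qed.

Lemma mdist_act_base g p : (N (base p) (act g (base p)))%:R <=
  mdist (epi p) (ract g (epi p)) + 2.
Proof.
by rewrite ract_epi -eend_act; have [] := mdist_base_le p (epact g p).
Qed.

Lemma realization_hyperbolic (c : nat) :
  (forall o x y z, (N x z + N o y <= maxn (N x y + N o z) (N y z + N o x) + c)%N) ->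
  gromov_hyperbolic Y.
Proof.
(* The difference of two Gromov products is half a combination of four distances, each rounded with
   error 2, and half of c + 8 is at most c + 4. *)
move=> N4; exists (c%:R + 4); first by rewrite addr_ge0.
move=> o x y z; rewrite /gromov_product.
have [po ->] := epiP o; have [px ->] := epiP x.
have [py ->] := epiP y; have [pz ->] := epiP z.
have := N4 (base po) (base px) (base py) (base pz).
have [ox1 ox2] := mdist_base_le po px; have [oy1 oy2] := mdist_base_le po py.
have [oz1 oz2] := mdist_base_le po pz; have [xy1 xy2] := mdist_base_le px py.
have [yz1 yz2] := mdist_base_le py pz; have [xz1 xz2] := mdist_base_le px pz.
have c0 : 0 <= c%:R :> R by [].
rewrite addn_maxl leq_max => /orP[]; rewrite -(ler_nat R) !natrD => h.
  rewrite lerBlDr ge_min; apply/orP; left; lra.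
rewrite lerBlDr ge_min; apply/orP; right; lra.
Qed.

Lemma realization_acylindrical :
  (forall E : nat, exists r M : nat, forall x y, (r <= N x y)%N ->
    exists f : G -> nat, (forall g, (N x (act g x) <= E)%N ->
      (N y (act g y) <= E)%N -> (f g < M)%N) /\
    (forall g h, (N x (act g x) <= E)%N -> (N y (act g y) <= E)%N ->
      (N x (act h x) <= E)%N -> (N y (act h y) <= E)%N -> f g = f h -> g = h)) ->
  acylindrical ract.
Proof.
move=> NA eps eps0; pose E := Num.bound (eps + 2).
have epsE : eps + 2 < E%:R by apply: archi_boundP; lra.
have [r [M rM]] := NA E; exists (r%:R + 3), M.+1; split=> // x y.
have [p ->] := epiP x; have [q ->] := epiP y => pq.
have [|f [fM finj]] := rM (base p) (base q).
  by rewrite -(ler_nat R); have [h _] := mdist_base_le p q; lra.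
have small g s : mdist (epi s) (ract g (epi s)) <= eps ->
    (N (base s) (act g (base s)) <= E)%N.
  by move=> h; rewrite -(ler_nat R); have := mdist_act_base g s; lra.
pose S := [set g | mdist (epi p) (ract g (epi p)) <= eps /\
                   mdist (epi q) (ract g (epi q)) <= eps].
rewrite -/S; have finjS : {in S &, injective f}.
  by move=> g h; rewrite !inE => -[gp gq] [hp hq]; apply: finj; exact: small.
rewrite -(card_le_eql (inj_card_eq finjS)); apply: subset_card_le.
move=> _ [g [gp gq] <-] /=; by apply: ltnW; rewrite ltnS fM //; exact: small.
Qed.

Lemma realization_loxodromic (g : G) (o : V) (L : nat) :
  (forall n, n <= N o (act (g ^+ n)%g o))%N ->
  (forall n, N o (act (g ^+ n)%g o) <= n * L)%N -> loxodromic ract g.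
Proof.
move=> lower upper; exists (epi (vert o)), (L%:R + 1), 0.
have L1 : 1 <= L%:R + 1 :> R by rewrite lerDr.
have L0 : 0 < L%:R + 1 :> R by apply: lt_le_trans L1.
split=> // i j.
have key a n : (L%:R + 1)^-1 * n%:R <= (N (act (expgz g a) o)
      (act (expgz g (a + n%:Z)) o))%:R :> R /\
    (N (act (expgz g a) o) (act (expgz g (a + n%:Z)) o))%:R <= (L%:R + 1) * n%:R :> R.
  rewrite expgzDn actM actN; have := lower n; have := upper n.
  rewrite -!(ler_nat R) natrM => u l; split.
    by apply: le_trans l; rewrite ler_piMl // invf_le1.
  by apply: le_trans u _; rewrite mulrC ler_wpM2r // lerDl.
rewrite subr0 addr0 !ract_vert epi_dist (edist_vert R NG).
have [ij|/ltW ji] := leP i j.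
  have [n ->] : exists n : nat, j = i + n%:Z by exists (absz (j - i)); lia.
  have -> : `|i - (i + n%:Z)| = n%:Z by lia.
  by rewrite -pmulrn; have [-> ->] := key i n.
have [n ->] : exists n : nat, i = j + n%:Z by exists (absz (i - j)); lia.
have -> : `|j + n%:Z - j| = n%:Z by lia.
by rewrite (graph_sym NG) -pmulrn; have [-> ->] := key j n.
Qed.

(** A fixed class contains both s and its image under g, so these are asymptotic; the double limit
    is then read on the diagonal. *)
Lemma boundary_fix_near g xi s o (A : R) : boundary_fix ract g xi ->
  gromov_asymptotic s s -> xi = boundary_point s ->
  exists n, forall i, (n <= i)%N -> A <= gromov_product o (s i) (ract g (s i)).
Proof.
move=> [_ gxi] ss xiE; have sxi : xi s by rewrite xiE.
have : xi (ract g \o s) by rewrite -gxi; exists s.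
rewrite xiE => -[_ /(_ o A)] [[P Q]] /= [[m _ mP] [n _ nQ]] PQ.
exists (maxn m n) => i mni; apply: (PQ (i, i)); split=> /=.
- by apply: mP => /=; apply: leq_trans mni; rewrite leq_maxl.
- by apply: nQ => /=; apply: leq_trans mni; rewrite leq_maxr.
Qed.

(** Far along a sequence converging to a common fixed point, the Gromov products at o with the
    images under g and under h are both at least c + 4. The hypothesis, with three distances rounded
    by 2, bounds one of them by (c + 6) / 2. *)
Lemma boundary_fix_disjoint (g h : G) (o : V) (c : nat) :
  (forall z, (N z o + N o (act g z) <= N z (act g z) + c)%N \/
             (N z o + N o (act h z) <= N z (act h z) + c)%N) ->
  boundary_fix ract g `&` boundary_fix ract h = set0.
Proof.
move=> off; rewrite -subset0 => xi [gxi hxi].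
have [[s ss /esym xiE] _] := gxi.
have [n1 h1] := boundary_fix_near (epi (vert o)) (c%:R + 4) gxi ss xiE.
have [n2 h2] := boundary_fix_near (epi (vert o)) (c%:R + 4) hxi ss xiE.
pose i := maxn n1 n2.
have {}h1 := h1 i (leq_maxl _ _); have {}h2 := h2 i (leq_maxr _ _).
have [p pE] := epiP (s i); rewrite pE in h1 h2.
have key k : c%:R + 4 <= gromov_product (epi (vert o)) (epi p) (ract k (epi p)) ->
    (N (base p) o + N o (act k (base p)) <= N (base p) (act k (base p)) + c)%N -> False.
  rewrite /gromov_product ract_epi -eend_act -(ler_nat R) !natrD => A B.
  have [a1 a2] := mdist_base_le (vert o) p.
  have [b1 b2] := mdist_base_le (vert o) (epact k p).
  have [c1 c2] := mdist_base_le p (epact k p).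
  rewrite !eend_vert (graph_sym NG o) in a1 a2 b1 b2.
  have c0 : 0 <= c%:R :> R by [].
  by move: A; rewrite ler_pdivlMr //; lra.
by have [] := off (base p); exact: key.
Qed.

End GraphAction.

Section TreeHyperbolic.
Variables (R : realType) (G : groupType) (V : Type) (act : G -> V -> V).
Variable d : V -> V -> nat.
Hypothesis dT : tree_metric d.
Hypothesis act1 : forall x, act 1%g x = x.
Hypothesis actM : forall g h x, act (g * h)%g x = act g (act h x).
Hypothesis actd : forall g x y, d (act g x) (act g y) = d x y.
Variables (o : V) (g a : G).
Notation h := (a * g * a^-1)%g.
Hypothesis og : (1 < d o (act g o))%N.
Hypothesis o_fix : forall k, d (act k o) o = 0%N ->
  d (act k (act g o)) (act g o) = 0%N -> k = 1%g.
Hypothesis ao : d (act a o) o = 0%N.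
Hypothesis gVg : btw d (act (g^-1)%g o) o (act g o).
Hypothesis gh : forall x y, x = g \/ x = (g^-1)%g -> y = h \/ y = (h^-1)%g ->
  btw d (act x o) o (act y o).

Notation N := (freedist dT actd og).

Lemma freedist_graph : graph_metric N.
Proof.
split=> [x|x y|x y|x y z|x y n].
- exact: gdistxx.
- exact: gdist_eq0.
- exact: freedistC.
- exact: gdist_tri.
- move=> xy; have [z xz zy] := gdist_step xy.
  by exists z; split; [exact: freedist_free|exact: zy].
Qed.

Let d0l x x' y : d x x' = 0%N -> d x y = d x' y.
Proof.
move=> xx'; have := tree_tri dT x' x y; have := tree_tri dT x x' y.
by rewrite (tree_sym dT x' x) xx'; lia.
Qed.

Let d0r x y y' : d y y' = 0%N -> d x y = d x y'.
Proof. by rewrite !(tree_sym dT x); exact: d0l. Qed.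

Let aVo : d (act (a^-1)%g o) o = 0%N.
Proof. by rewrite -(actd a) -actM mulgV act1 (tree_sym dT). Qed.

Let hconj x : d (act (a * x * a^-1)%g o) (act (a * x)%g o) = 0%N.
Proof. by rewrite actM actd. Qed.

Let hV : (h^-1 = a * g^-1 * a^-1)%g.
Proof. by rewrite !invgM invgK mulgA. Qed.

Lemma axis_conj : btw d (act (h^-1)%g o) o (act h o).
Proof.
rewrite /btw hV (d0l _ (hconj (g^-1)%g)) (d0r _ (hconj g)) (d0l _ (hconj (g^-1)%g)).
rewrite (d0r _ (hconj g)) -(d0l _ ao) -(d0r (act (a * g^-1)%g o) ao).
by rewrite !actM !actd; exact: gVg.
Qed.

Lemma copy_axis : copy act d o (act g o) o (act g o).
Proof.
exists o, (act g o); split; first by exists 1%g; left; rewrite !act1.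
by rewrite !(tree_refl dT) addn0.
Qed.

Lemma copy_axis_conj : copy act d o (act g o) o (act h o).
Proof.
exists (act a o), (act a (act g o)); split; first by exists a; left.
rewrite !(d0r _ (hconj g)) -actM (tree_refl dT) addn0 (tree_sym dT o) ao add0n.
exact: d0l.
Qed.

(** The segment is [o, g o], so copies tile the axis of g and, as a fixes o, also that of h. Both
    axes pass through o, and by [gh] every z projects to o on at least one of them, which rules out
    a common boundary point. *)
Theorem tree_acylindrically_hyperbolic : acylindrically_hyperbolic R G.
Proof.
have actN := freedist_act dT act1 actM actd og.
have hC := copy_axis_conj; have hVh := axis_conj.
exists (realization R freedist_graph), (@ract R G V act _ freedist_graph); split.
- exact: realization_geodesic.
- apply: realization_hyperbolic; exact: (freedist_four dT actd og).
split.
- exact: ract_isometric.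
- apply: realization_acylindrical => //.
  exact: (freedist_acyl dT act1 actM actd og o_fix).
have lox k : btw d (act (k^-1)%g o) o (act k o) ->
    copy act d o (act g o) o (act k o) ->
    loxodromic (@ract R G V act _ freedist_graph) k.
  move=> kb kc; apply: (@realization_loxodromic _ _ _ _ _ _ act1 actM actN _ o (N o (act k o))).
  - exact: (axis_lower dT act1 actM actd og kb kc).
  - exact: (axis_upper dT act1 actM actd og o k).
exists g, h; split; [exact: lox gVg copy_axis|exact: lox hVh hC|].
apply: (@boundary_fix_disjoint R G V act _ freedist_graph act1 actM actN g h o 2) => z.
have [[zh zhV]|[zh zhV]] := axes_off dT z (gh (or_introl erefl) (or_introl erefl))
  (gh (or_introl erefl) (or_intror erefl)) (gh (or_intror erefl) (or_introl erefl))
  (gh (or_intror erefl) (or_intror erefl)).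
- by left; exact: (axis_off dT act1 actM actd og copy_axis).
- by right; exact: (axis_off dT act1 actM actd og hC).
Qed.

End TreeHyperbolic.

Section AmalgamHyperbolic.
Variables (E : bool -> groupType) (C : groupType) (iota : forall b, C -> E b).
Hypothesis iotaM : forall b, {morph iota b : x y / (x * y)%g}.
Hypothesis iota_inj : forall b, injective (iota b).

Notation P := (amalgam iota).
Notation inC := (inC iota).
Notation inj := (inj iota).
Notation d := (listd (@code E C iota)).

Lemma inCV b (x : E b) : inC (x^-1)%g <-> inC x.
Proof.
have h c : iota b (c^-1)%g = ((iota b c)^-1)%g.
  have i1 : iota b 1%g = 1%g by apply: (@mulgI _ (iota b 1%g)); rewrite -iotaM !mulg1.
  by apply: (@mulgI _ (iota b c)); rewrite -iotaM !mulgV.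
by split=> -[c xc]; exists (c^-1)%g; rewrite h -xc ?invgK.
Qed.

Variables (X a : E true) (Y : E false).
Hypothesis XC : ~ inC X.
Hypothesis aC : ~ inC a.
Hypothesis XaC : ~ inC (X * a)%g.
Hypothesis XaVC : ~ inC (X * a^-1)%g.
Hypothesis XaXVC : ~ inC (X * a * X^-1)%g.
Hypothesis YC : ~ inC Y.
Hypothesis XYC : forall c1 c2 c3, (Y * iota false c1)%g = (iota false c2 * Y)%g ->
  (X * iota true c2)%g = (iota true c3 * X)%g -> c2 = 1%g.

Variables (R : realType) (G : groupType) (f : G -> P) (g a' : G).
Hypothesis fM : {morph f : x y / (x * y)%g}.
Hypothesis f_inj : injective f.
Hypothesis fg : f (g^-1)%g = (inj Y * inj X * inj Y * inj X)%g.
Hypothesis fa : f a' = inj a.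

Let act (k : G) (v : vertex iota) : vertex iota := vact (f k) v.
Let o : vertex iota := (true, 1%g).
Let T := vertex_tree iotaM iota_inj.

Let f1 : f 1%g = 1%g.
Proof. by apply: (@mulgI _ (f 1%g)); rewrite -fM !mulg1. Qed.

Let fV k : f (k^-1)%g = ((f k)^-1)%g.
Proof. by apply: (@mulgI _ (f k)); rewrite -fM !mulgV. Qed.

Let act1 v : act 1%g v = v. Proof. by rewrite /act f1 vact1. Qed.

Let actM k l v : act (k * l)%g v = act k (act l v).
Proof. by rewrite /act fM vactM. Qed.

Let actd k v w : d (act k v) (act k w) = d v w.
Proof. exact: vactd. Qed.

Let dist b s k l : reduced iota b s -> f (k^-1 * l)%g = prodl iota s ->
  d (act k o) (act l o) = tag_dist (map tag s).
Proof.
move=> sr kl; apply: (listd_reduced iotaM iota_inj sr).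
by rewrite /act /vact /= !mul1g invgK -kl fM fV.
Qed.

Let distl b s l : reduced iota b s -> f l = prodl iota s ->
  d o (act l o) = tag_dist (map tag s).
Proof. by move=> sr kl; rewrite -{1}(act1 o) (dist sr) // invg1 mul1g. Qed.

Notation Ym := (@mkl E false Y).
Notation Yv := (@mkl E false (Y^-1)%g).
Notation Xm := (@mkl E true X).
Notation Xv := (@mkl E true (X^-1)%g).
Notation mk := (@mkl E true).

Let fgE : f g = (inj X^-1 * inj Y^-1 * inj X^-1 * inj Y^-1)%g.
Proof. by rewrite -[LHS]invgK -fV fg !invgM !injV //= !mulgA. Qed.

Let nXv : ~ inC (X^-1)%g. Proof. by rewrite inCV. Qed.
Let nYv : ~ inC (Y^-1)%g. Proof. by rewrite inCV. Qed.
Let nav : ~ inC (a^-1)%g. Proof. by rewrite inCV. Qed.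
Let naX : ~ inC (a * X^-1)%g.
Proof. by rewrite -inCV invgM invgK. Qed.

Notation h := (a' * g * a'^-1)%g.

Let fh : f h = (inj a * inj X^-1 * inj Y^-1 * inj X^-1 * inj Y^-1 * inj a^-1)%g.
Proof. by rewrite !fM fV fa fgE !injV // !mulgA. Qed.

Let fhV : f (h^-1)%g = (inj a * inj Y * inj X * inj Y * inj X * inj a^-1)%g.
Proof. by rewrite fV fh !invgM !injV // !invgK !mulgA. Qed.

Let pos_g : d o (act g o) = 4%N.
Proof.
by rewrite (@distl true [:: Xv; Yv; Xv; Yv]) //= ?fgE ?mulg1 ?mulgA.
Qed.

Let pos_gV : d (act (g^-1)%g o) o = 4%N.
Proof.
rewrite (tree_sym T).
by rewrite (@distl false [:: Ym; Xm; Ym; Xm]) //= ?fg ?mulg1 ?mulgA.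
Qed.

Let pos_h : d o (act h o) = 4%N.
Proof.
rewrite (@distl true [:: mk (a * X^-1)%g; Yv; Xv; Yv; mk (a^-1)%g]) //=.
by rewrite fh injM ?mulg1 ?mulgA.
Qed.

Let pos_hV : d o (act (h^-1)%g o) = 4%N.
Proof.
rewrite (@distl true [:: mk a; Ym; Xm; Ym; mk (X * a^-1)%g]) //=.
by rewrite fhV injM ?mulg1 ?mulgA.
Qed.

Let pos_gg : d (act (g^-1)%g o) (act g o) = 8%N.
Proof.
rewrite (@dist true [:: Xv; Yv; Xv; Yv; Xv; Yv; Xv; Yv]) //=.
by rewrite invgK fM fgE mulg1 !mulgA.
Qed.

Let pos_gh : d (act g o) (act h o) = 8%N.
Proof.
rewrite (@dist false
  [:: Ym; Xm; Ym; mk (X * a * X^-1)%g; Yv; Xv; Yv; mk (a^-1)%g]) //=.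
by rewrite fM fg fh !injM ?mulg1 !mulgA.
Qed.

Let pos_ghV : d (act g o) (act (h^-1)%g o) = 8%N.
Proof.
rewrite (@dist false
  [:: Ym; Xm; Ym; mk (X * a)%g; Ym; Xm; Ym; mk (X * a^-1)%g]) //=.
by rewrite fM fg fhV !injM ?mulg1 !mulgA.
Qed.

Let pos_gVh : d (act (g^-1)%g o) (act h o) = 8%N.
Proof.
rewrite (@dist true
  [:: Xv; Yv; Xv; Yv; mk (a * X^-1)%g; Yv; Xv; Yv; mk (a^-1)%g]) //=.
by rewrite invgK fM fgE fh !injM ?mulg1 !mulgA.
Qed.

Let pos_gVhV : d (act (g^-1)%g o) (act (h^-1)%g o) = 8%N.
Proof.
rewrite (@dist true
  [:: Xv; Yv; Xv; Yv; mk a; Ym; Xm; Ym; mk (X * a^-1)%g]) //=.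
by rewrite invgK fM fgE fhV !injM ?mulg1 !mulgA.
Qed.

(** Fixing both ends puts x = f k and its conjugate by Y X Y X in the factor E true. A conjugate
    leaving C on the way would give a reduced word too long to lie there, so the conjugates of x by
    X, Y X and X Y X are elements c1, c2, c3 of C, and [XYC] kills c2. *)
Lemma amalgam_fix k : d (act k o) o = 0%N -> d (act k (act g o)) (act g o) = 0%N ->
  k = 1%g.
Proof.
move=> /(listd_coset iotaM iota_inj)[_ [x kx]].
move=> /(listd_coset iotaM iota_inj)[_ [x' kx']].
have fk : f k = inj x by move: kx; rewrite mul1g => /esym /divg1_eq ->.
pose W := (inj Y * inj X * inj Y * inj X)%g.
have {kx kx'} e : (W * inj x * W^-1 = inj x')%g.
  move: kx'; rewrite /= !mul1g -fV fg -/W fk mulgA => h.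
  by rewrite {1}h mulgVK mulgK.
have [c1 xc1] : inC (X * x * X^-1)%g.
  apply: contrapT => xC.
  have [] := @reduced_inj E C iota iotaM iota_inj false true
    [:: Ym; Xm; Ym; mk (X * x * X^-1)%g; Yv; Xv; Yv] x' => //; last by case.
  by rewrite /= mulg1 -e /W !injM !injV // !invgM !mulgA.
have [c2 xc2] : inC (Y * iota false c1 * Y^-1)%g.
  apply: contrapT => xC.
  have [] := @reduced_inj E C iota iotaM iota_inj false true
    [:: Ym; Xm; mkl (Y * iota false c1 * Y^-1)%g; Xv; Yv] x' => //; last by case.
  rewrite /= mulg1 -e /W !injM -(inj_iota iota true) -xc1 !injM !injV //.
  by rewrite !invgM !mulgA.
have [c3 xc3] : inC (X * iota true c2 * X^-1)%g.
  apply: contrapT => xC.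
  have [] := @reduced_inj E C iota iotaM iota_inj false true
    [:: Ym; mk (X * iota true c2 * X^-1)%g; Yv] x' => //; last by case.
  rewrite /= mulg1 -e /W !injM (inj_iota iota true false) -xc2.
  rewrite !injM -(inj_iota iota true) -xc1 !injM !injV //.
  by rewrite !invgM !mulgA.
have c21 : c2 = 1%g by apply: (XYC (c1 := c1) (c3 := c3)); rewrite -?xc2 -?xc3 mulgVK.
have i1 b : iota b 1%g = 1%g by apply: (@mulgI _ (iota b 1%g)); rewrite -iotaM !mulg1.
have c11 : iota false c1 = 1%g.
  by apply/eqP; rewrite -(conjg_eq1 _ (Y^-1)%g) conjgE invgK mulgA xc2 c21 i1.
have c1E : c1 = 1%g by apply: (@iota_inj false); rewrite c11 i1.
have x1 : x = 1%g.
  by apply/eqP; rewrite -(conjg_eq1 _ (X^-1)%g) conjgE invgK mulgA xc1 c1E i1.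
by apply: f_inj; rewrite f1 fk x1 inj1.
Qed.

(** The conditions on X and a say that the edges C, C X, C a^-1 and C X a^-1 at o are distinct; the
    paths from o to g^-1 o, g o, h^-1 o and h o start with them in this order. As f is only asked to
    be an injective morphism, a group given by another presentation can act through it. *)
Theorem amalgam_acylindrically_hyperbolic : acylindrically_hyperbolic R G.
Proof.
apply: (tree_acylindrically_hyperbolic (act := act) (o := o) (g := g) (a := a') R T
  act1 actM actd).
- by rewrite pos_g.
- exact: amalgam_fix.
- rewrite /act /vact /o /= fa mul1g -[X in d (_, X) _]mulg1 -injV.
  exact: listd_coset0.
- by rewrite /btw pos_gg pos_gV pos_g.
by move=> _ _ [] -> [] ->; rewrite /btw ?(tree_sym T (act g o) o) ?pos_gh ?pos_ghV
  ?pos_gVh ?pos_gVhV ?pos_gV ?pos_g ?pos_h ?pos_hV.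
Qed.

End AmalgamHyperbolic.

(** * Chains of Baumslag-Solitar groups *)

Section Syllables.

Definition syl (G : groupType) (x y : G) (s : bool * int) : G :=
  if s.1 then expgz x s.2 else expgz y s.2.

Definition evs (G : groupType) (x y : G) (s : seq (bool * int)) : G :=
  foldr (fun t p => (syl x y t * p)%g) 1%g s.

Fixpoint salt (b : bool) (s : seq (bool * int)) : bool :=
  if s is t :: s' then [&& t.1 == b, t.2 != 0 & salt (~~ b) s'] else true.

Lemma evs_cat (G : groupType) (x y : G) s t :
  evs x y (s ++ t) = (evs x y s * evs x y t)%g.
Proof. by elim: s => [|u s /= ->]; rewrite ?mul1g ?mulgA. Qed.

Lemma salt_cat b s t : salt b (s ++ t) = salt b s && salt (b (+) odd (size s)) t.
Proof.
elim: s b => [|u s IHs] b /=; first by rewrite addbF.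
by rewrite IHs -!andbA; do 3! congr (_ && _); case: b; case: (odd _).
Qed.

(* The normal form s' does not depend on the group, so it also computes in the free
   group on two generators. *)
Lemma syl_cons (t : bool * int) b s : salt b s -> exists s',
  (exists b', salt b' s') /\
  forall (G : groupType) (x y : G), (syl x y t * evs x y s)%g = evs x y s'.
Proof.
case: t => c z; have [->|z0] := eqVneq z 0.
  by move=> sb; exists s; split; [exists b|move=> G x y; rewrite /syl; case: c; rewrite mul1g].
case: s => [|[c' z'] s].
  by exists [:: (c, z)]; split; [exists c; rewrite /= eqxx z0|].
case/and3P => /= /eqP -> z'0 sb {c'}; have [->|cb] := eqVneq c b; last first.
  exists [:: (c, z), (b, z') & s]; split=> //; exists c.
  rewrite /= eqxx z0 z'0 /=; case: c b cb sb => [] [] //= _ ->.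
have [zz|zz] := eqVneq (z + z') 0.
  exists s; split; first by exists (~~ b).
  by move=> G x y /=; rewrite /syl /= mulgA; case: (b); rewrite -expgzD zz mul1g.
exists ((b, z + z') :: s); split; first by exists b; rewrite /= eqxx zz.
by move=> G x y /=; rewrite /syl /= mulgA; case: (b); rewrite -expgzD.
Qed.

Lemma word_syl (w : word bool) : exists s, (exists b, salt b s) /\
  forall (G : groupType) (f : bool -> G), evalw f w = evs (f true) (f false) s.
Proof.
elim: w => [|[c e] w [s [[b sb] IH]]]; first by exists [::]; split; [exists true|].
have [s' [bs' s'E]] := syl_cons (c, (-1) ^+ e) sb; exists s'; split => // G f.
rewrite -s'E -IH /=; congr (_ * _)%g; rewrite /evall /syl /=.
by case: (c); case: (e).
Qed.

(** Splits off the powers of y at both ends, which can then be merged with a neighbouring element of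
    the factor containing y; the core m begins and ends with a power of x. *)
Lemma evs_trim s b : salt b s ->
  (exists j, forall (G : groupType) (x y : G), evs x y s = expgz y j) \/
  (exists i j m, [/\ salt true m, odd (size m) &
     forall (G : groupType) (x y : G),
       evs x y s = (expgz y i * evs x y m * expgz y j)%g]).
Proof.
have tail m : salt true m -> m <> [::] -> exists j m', [/\ salt true m', odd (size m') &
     forall (G : groupType) (x y : G), evs x y m = (evs x y m' * expgz y j)%g].
  case/lastP: m => // m [c z] sm _; have [od|od] := boolP (odd (size m)).
    exists z, m; move: sm; rewrite -cats1 salt_cat od addTb => /andP[sm /= /and3P[/eqP cE _ _]].
    by split => // G x y; rewrite evs_cat /= mulg1 /syl /= cE.
  exists 0, (rcons m (c, z)); split => //; first by rewrite size_rcons.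
  by move=> G x y; rewrite mulg1.
case: s => [|[c z] s] /=; first by left; exists 0.
case/and3P => /eqP cb z0 sb; case: c cb => cb; rewrite -{}cb {b} in sb *.
  right; have [||j [m [sm om mE]]] := tail ((true, z) :: s); rewrite /= ?z0 //.
  by exists 0, j, m; split => // G x y; rewrite mul1g -mE.
case: s sb => [_|t s sb].
  by left; exists z => G x y; rewrite /= mulg1.
right; have [//|j [m [sm om mE]]] := tail (t :: s) sb.
by exists z, j, m; split => // G x y; rewrite -mulgA -mE.
Qed.

Lemma evs_morph (G H : groupType) (h : G -> H) x y s : {morph h : u v / (u * v)%g} ->
  h (evs x y s) = evs (h x) (h y) s.
Proof.
move=> hM; have h1 : h 1%g = 1%g by apply: (@mulgI _ (h 1%g)); rewrite -hM !mulg1.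
have hV u : h (u^-1)%g = ((h u)^-1)%g.
  by apply: (@mulgI _ (h u)); rewrite -hM !mulgV.
have hX u n : h (u ^+ n)%g = (h u ^+ n)%g.
  by elim: n => // n IHn; rewrite !expgS hM IHn.
have hz u z : h (expgz u z) = expgz (h u) z by case: z => n /=; rewrite ?hV hX.
by elim: s => //= -[c z] s IHs; rewrite hM IHs /syl; case: c; rewrite hz.
Qed.

End Syllables.

Definition zgroup : Type := int.
HB.instance Definition _ := Choice.on zgroup.
HB.instance Definition _ := isGroup.Build zgroup
  (@addrA int) (@add0r int) (@addr0 int) (@addNr int) (@subrr int).

Section BaumslagSolitar.
Variables (m k : int).
Hypothesis m0 : m != 0.
Hypothesis k0 : k != 0.
Hypothesis mk : `|m| != `|k|.

Definition bs_rels : set (word bool * word bool) :=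
  [set (wgen true ++ wexpz false m ++ invw (wgen true), wexpz false k)].
Definition bs_group : groupType := presented bs_rels.
Definition bs_gen (c : bool) : bs_group := pres_gen bs_rels c.
Notation a := (bs_gen true).
Notation b := (bs_gen false).

Lemma bs_rel : (a * expgz b m * a^-1)%g = expgz b k.
Proof.
have := @pres_rels _ bs_rels (wgen true ++ wexpz false m ++ invw (wgen true)) _ erefl.
by rewrite !evalw_cat !evalw_wexpz /= !mulg1 mulgA.
Qed.

Lemma bs_univ (H : groupType) (x y : H) : (x * expgz y m * x^-1)%g = expgz y k ->
  exists h : bs_group -> H, [/\ {morph h : u v / (u * v)%g}, h a = x & h b = y].
Proof.
move=> xy; have [|h [[hM hgen] _]] := @pres_univ _ bs_rels H (fun c => if c then x else y).
  move=> u v uv; have uE : u = _ ++ _ ++ _ := congr1 fst uv.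
  have vE : v = wexpz _ _ := congr1 snd uv; rewrite uE vE /=.
  by rewrite evalw_cat !evalw_wexpz /= mulg1 mulgA.
by exists h; split => //; exact: hgen.
Qed.

Let lam : rat := k%:~R / m%:~R.
Let lam0 : lam != 0. Proof. by rewrite mulf_neq0 ?invr_eq0 ?intr_eq0. Qed.

(* The action on the affine line: a is the homothety of ratio k / m and b is the
   translation by 1. *)
Let aff (l : bool * bool) (x : rat) : rat :=
  if l.1 then (if l.2 then lam^-1 * x else lam * x)
  else (if l.2 then x - 1 else x + 1).

Let aff_wexpz x z : foldr aff x (wexpz false z) = x + z%:~R.
Proof.
have h n e : foldr aff x (nseq n (false, e)) = if e then x - n%:R else x + n%:R.
  elim: n => [|n IHn] /=; first by case: (e); rewrite ?mulr0n ?subr0 ?addr0.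
  by rewrite IHn; case: (e); rewrite /aff /= -natr1; ring.
rewrite /wexpz h; case: z => n /=; first by [].
by rewrite NegzE mulrNz.
Qed.

Let aff_eq u v : pres_eq bs_rels u v -> forall x, foldr aff x u = foldr aff x v.
Proof.
move=> uv x; apply: (pres_eq_fold (P := fun=> True)) uv x I => //.
  move=> [[] []] x _; rewrite /aff /= ?mulVKf ?mulKf //; ring.
move=> {}u {}v uv {}x _; have uE : u = _ ++ _ ++ _ := congr1 fst uv.
have vE : v = wexpz _ _ := congr1 snd uv; rewrite uE vE /= foldr_cat !aff_wexpz /= /aff /=.
by rewrite mulrDr mulVKf // /lam divfK ?intr_eq0.
Qed.

Let A (p : bs_group) (x : rat) : rat := foldr aff x (repr p).

Let A_class w x : A (pres_class bs_rels w) x = foldr aff x w.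
Proof. exact: aff_eq (pres_repr bs_rels w) x. Qed.

Let AM p q x : A (p * q)%g x = A p (A q x).
Proof. by rewrite [X in A X x]/(pres_mul p q) A_class foldr_cat. Qed.

Let A1 x : A 1%g x = x. Proof. exact: A_class. Qed.

Let AV p x y : A p y = x -> A (p^-1)%g x = y.
Proof. by move=> <-; rewrite -AM mulVg A1. Qed.

Let Aa z x : A (expgz a z) x = lam ^ z * x.
Proof.
have h n y : A (a ^+ n)%g y = lam ^+ n * y.
  elim: n y => [|n IHn] y; first by rewrite mul1r A1.
  by rewrite expgS AM IHn exprS -mulrA; exact: A_class.
case: z => n; first exact: h.
by apply: AV; rewrite h NegzE -exprnN mulVKf // expf_neq0.
Qed.

Let Ab z x : A (expgz b z) x = x + z%:~R.
Proof. by rewrite -aff_wexpz -A_class -pres_evalw evalw_wexpz. Qed.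

Let lam_root z : lam ^ z = 1 -> z = 0.
Proof.
have h n : lam ^+ n = 1 -> n = 0%N.
  case: n => // n; move/(congr1 Num.norm); rewrite normrX normr1 => /eqP.
  rewrite pexpr_eq1 // /lam normf_div => /eqP /divr1_eq /eqP.
  by rewrite -!intr_norm eqr_int eq_sym (negbTE mk).
case: z => n; first by move=> /h ->.
by rewrite NegzE -exprnN => /(congr1 GRing.inv); rewrite invrK invr1 => /h.
Qed.

(** As affine maps, a^i fixes 0 and b^j is a translation, so both are the identity; since |k / m| is
    not 1, this forces i = 0. *)
Lemma bs_sep i j : expgz a i = expgz b j -> i = 0 /\ j = 0.
Proof.
move=> ij; have := Ab j 0; have := Ab j 1; rewrite -ij !Aa mulr0 add0r mulr1.
move=> li /esym/eqP; rewrite intr_eq0 => /eqP j0; split=> //.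
by apply: lam_root; rewrite li j0 addr0.
Qed.

(* The conjugate of b is a translation by (k / m)^e, and one of k / m and m / k is not
   an integer. *)
Lemma bs_conj : exists e : int, forall i z j,
  (expgz a e * b * expgz a (- e))%g <> (expgz b i * expgz a z * expgz b j)%g.
Proof.
have [e lamZ] : exists e : int, forall z : int, lam ^ e != z%:~R.
  have [[z1 z1E]|noz] := pselect (exists z : int, lam = z%:~R); last first.
    by exists 1 => z; apply/eqP => h; apply: noz; exists z.
  exists (-1) => z; apply/eqP => zE; case/eqP: mk.
  have z12 : z1 * z = 1.
    apply/eqP; rewrite -(eqr_int rat) intrM -z1E -zE -[lam in X in X == _]expr1z.
    by rewrite -expfzDr.
  have kz : k = z1 * m.
    by apply/eqP; rewrite -(eqr_int rat) intrM -z1E /lam divfK ?intr_eq0.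
  have : `|z1| = 1.
    have : `|z1| * `|z| = 1 by rewrite -normrM z12.
    have : z1 != 0 by apply: contra_eq_neq z12 => ->; rewrite mul0r.
    have : z != 0 by apply: contra_eq_neq z12 => ->; rewrite mulr0.
    nia.
  by rewrite kz normrM => ->; rewrite mul1r.
exists e => i z j h.
have Ae x : A (expgz a e * b * expgz a (- e))%g x = x + lam ^ e.
  rewrite !AM !Aa -[b in A b]/(expgz b 1) Ab mulrDr mulr1 mulrA -expfzDr // subrr.
  by rewrite expr0z mul1r.
have A0 := Ae 0; have Ai := Ae 1; rewrite h !AM !Ab !Aa in A0 Ai.
(* Comparing the values at 0 and at 1 isolates the linear part, so lam ^ z = 1. *)
have z0 : z = 0.
  apply: lam_root; move: A0 Ai; rewrite !add0r mulrDr mulr1.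
  by set q := lam ^ z * _; lra.
move: A0; rewrite z0 expr0z mul1r !add0r -intrD => /esym/eqP.
by apply/negP/lamZ.
Qed.

(** The morphism onto the integers that kills b and sends a to 1 does not see conjugation. *)
Lemma bs_conj_gen p j : (p^-1 * a * p)%g <> expgz b j.
Proof.
have e1 z : expgz (1%g : zgroup) z = 1%g.
  by case: z => n /=; rewrite expg1n ?invg1.
have [|h [hM ha hb]] := @bs_univ zgroup (Posz 1) 1%g; first by rewrite !e1 mulg1 mulgV.
move=> /(congr1 h); rewrite !hM ha.
have -> : h (expgz b j) = 1%g.
  by have := evs_morph b b [:: (true, j)] hM; rewrite /= !mulg1 hb /syl /= e1.
have hV : (h (p^-1)%g * h p)%g = 1%g.
  by rewrite -hM mulVg; have := evs_morph 1%g 1%g [::] hM.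
have zC (u v : zgroup) : (u * v)%g = (v * u)%g by exact: addrC.
by rewrite -mulgA (zC (Posz 1 : zgroup)) mulgA hV mul1g.
Qed.

End BaumslagSolitar.

Definition chain_rel (G : groupType) (m k : nat -> int) (b : nat -> G) (i : nat) : Prop :=
  (b i * expgz (b i.+1) (m i) * (b i)^-1)%g = expgz (b i.+1) (k i).

(* L is presented by the generators b 0, ..., b r and the relations of indices
   0, ..., r - 1. *)
Record chain_group (m k : nat -> int) (r : nat) (L : groupType) (b : nat -> L) : Prop :=
  ChainGroup {
  chain_rels : forall i, (i < r)%N -> chain_rel m k b i;
  chain_univ : forall (H : groupType) (f : nat -> H),
    (forall i, (i < r)%N -> chain_rel m k f i) ->
    exists h : L -> H, {morph h : x y / (x * y)%g} /\
      forall i, (i <= r)%N -> h (b i) = f i;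
  chain_ends : forall i j, expgz (b 0%N) i = expgz (b r) j -> i = 0 /\ j = 0 }.

(* On alternating syllables, evs x y ranges over the subgroup C generated by x and y:
   C is free on x and y when free_pair holds, and separating says that C and g C g^-1
   meet inside the powers of y. *)
Definition free_pair (L : groupType) (x y : L) : Prop :=
  forall s c, salt c s -> evs x y s = 1%g -> s = [::].

Definition separating (L : groupType) (x y g : L) : Prop :=
  forall s s' c c', salt c s -> salt c' s' ->
    (evs x y s * g)%g = (g * evs x y s')%g ->
    (exists j, evs x y s = expgz y j) /\ (exists j, evs x y s' = expgz y j).

Definition outside (L : groupType) (x y g : L) : Prop :=
  forall s c, salt c s -> g <> evs x y s.

(** For X the inverse of g, the last six clauses keep X^-1, X, a, X a, X a^-1 and X a X^-1 out of
    the free subgroup. The first factor supplies X and a in this way, and the second supplies its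
    own g as Y. *)
Definition twisted (L : groupType) (x a y : L) : Prop :=
  exists e, let g := (expgz a e * y * expgz a (- e))%g in
    separating x y g /\
    [/\ outside x y g, outside x y (g^-1)%g, outside x y a &
      [/\ outside x y (g^-1 * a)%g, outside x y (g^-1 * a^-1)%g &
          outside x y (g^-1 * a * g)%g]].

(** * Adding a generator: the amalgam of a chain group and a Baumslag-Solitar group over the
    integers *)

Section ChainStep.
Variables (m k : nat -> int) (r : nat) (L : groupType) (b : nat -> L).
Hypothesis Lb : chain_group m k r b.
Hypothesis mr : m r != 0.
Hypothesis kr : k r != 0.
Hypothesis mkr : `|m r| != `|k r|.

Let B := bs_group (m r) (k r).
Let ba : B := bs_gen (m r) (k r) true.
Let bb : B := bs_gen (m r) (k r) false.
Let E (c : bool) : groupType := if c then L else B.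
Let iota (c : bool) : zgroup -> E c :=
  if c return zgroup -> E c then expgz (b r) else expgz ba.

Let iotaM c : {morph iota c : x y / (x * y)%g}.
Proof. by case: c => x y; exact: expgzD. Qed.

Let iota_inj c : injective (iota c).
Proof.
have inj0 (G : groupType) (x : G) : (forall z, expgz x z = 1%g -> z = 0) ->
    injective (expgz x : zgroup -> G).
  move=> h y z yz; apply/eqP; rewrite -subr_eq0; apply/eqP/h.
  by rewrite expgzD expgzN yz mulgV.
case: c; apply: inj0 => z z1.
  by have [] := chain_ends Lb (i := 0) (esym z1).
by have [] := bs_sep mr kr mkr (j := 0) z1.
Qed.

Let P := amalgam iota.
Let inL (x : L) : P := @inj E zgroup iota true x.
Let inB (x : B) : P := @inj E zgroup iota false x.
Let b' (i : nat) : P := if (i <= r)%N then inL (b i) else inB bb.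

Let inLM : {morph inL : x y / (x * y)%g}. Proof. exact: (injM iota (b := true)). Qed.
Let inBM : {morph inB : x y / (x * y)%g}. Proof. exact: (injM iota (b := false)). Qed.

Let inB_inj : injective inB.
Proof. exact: (inj_inj iotaM iota_inj (b := false)). Qed.

Let hom_expgz (G H : groupType) (h : G -> H) x z : {morph h : u v / (u * v)%g} ->
  h (expgz x z) = expgz (h x) z.
Proof.
by move=> hM; have := evs_morph x x [:: (true, z)] hM; rewrite /= !mulg1.
Qed.

Let hom1 (G H : groupType) (h : G -> H) : {morph h : u v / (u * v)%g} -> h 1%g = 1%g.
Proof. by move=> hM; exact: (evs_morph 1%g 1%g [::] hM). Qed.

Let homV (G H : groupType) (h : G -> H) x : {morph h : u v / (u * v)%g} ->
  h (x^-1)%g = ((h x)^-1)%g.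
Proof. by move=> hM; have := hom_expgz x (-1) hM. Qed.

Let br_ba : inL (b r) = inB ba.
Proof. exact: (inj_iota iota true false (Posz 1)). Qed.

Let b'_rels i : (i < r.+1)%N -> chain_rel m k b' i.
Proof.
rewrite ltnS leq_eqVlt => /predU1P[->|ir]; rewrite /chain_rel /b'.
  by rewrite leqnn ltnn br_ba -!hom_expgz // -homV // -!inBM bs_rel.
rewrite ir ltnW // -!hom_expgz // -homV // -!inLM.
by have := chain_rels Lb ir; rewrite /chain_rel => ->.
Qed.

Let b'_univ (H : groupType) (f : nat -> H) :
  (forall i, (i < r.+1)%N -> chain_rel m k f i) ->
  exists h : P -> H, {morph h : x y / (x * y)%g} /\
    forall i, (i <= r.+1)%N -> h (b' i) = f i.
Proof.
move=> fr; have [|hL [hLM hLb]] := chain_univ Lb (f := f).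
  by move=> i ir; apply: fr; exact: ltnW.
have [hB [hBM hBa hBb]] := bs_univ (fr r (leqnn _)).
pose hE c : E c -> H := if c return E c -> H then hL else hB.
have [||h [hM hh]] := @amalgam_univ E zgroup iota H hE.
- by case.
- by move=> z; rewrite /hE /iota /= !hom_expgz // hLb // hBa.
exists h; split => // i; rewrite /b'; case: (leqP i r) => [ir _|ri ir].
  by rewrite (hh true) /hE hLb.
by rewrite (hh false) /hE hBb; congr f; apply/eqP; rewrite eqn_leq ri ir.
Qed.

Let x := b' 0%N.
Let y := b' r.+1.

Let xE : x = inL (b 0%N). Proof. by []. Qed.
Let yE : y = inB bb. Proof. by rewrite /y /b' ltnn. Qed.

Let lsyl (t : bool * int) : letter E :=
  if t.1 then @mkl E true (expgz (b 0%N) t.2) else @mkl E false (expgz bb t.2).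

Let lsylE s : prodl iota (map lsyl s) = evs x y s.
Proof.
elim: s => //= t s ->; congr (_ * _)%g; rewrite /lsyl /syl xE yE.
by case: (t.1); rewrite /= -hom_expgz.
Qed.

(** Nonzero powers of the first generator of L are not powers of its last one, by [chain_ends], and
    nonzero powers of [bb] are not powers of [ba]. So alternating words in x and y are already
    reduced, which gives freeness. *)
Let lsyl_reduced c s : salt c s -> reduced iota c (map lsyl s).
Proof.
elim: s c => //= [[c z] s] IHs c' /= /and3P[/eqP <- z0 /IHs sr].
rewrite /lsyl; case: c sr => sr /=; split=> // -[z' /= zz'].
  by have [z'0 _] := chain_ends Lb zz'; rewrite z'0 in z0.
by have [_ z'0] := bs_sep mr kr mkr (esym zz'); rewrite z'0 in z0.
Qed.

Let lsyl_inB c s u : salt c s -> evs x y s = inB u ->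
  exists j, u = expgz bb j /\ evs x y s = expgz y j.
Proof.
move=> sc su; have [|sz] := reduced_inj iotaM iota_inj (lsyl_reduced sc) (etrans (lsylE s) su).
  case: s sc su => // _ /= u1 _; exists 0; split=> //.
  by apply: inB_inj; rewrite -u1 hom1.
case: sz => sz cE; case: s sc su sz => // -[c1 z] [|//] /= /andP[/eqP c1E _] su _.
exists z; rewrite /= mulg1 /syl c1E cE /= in su *; split => //.
by apply: inB_inj; rewrite -su yE -hom_expgz.
Qed.

Lemma step_free : free_pair x y.
Proof.
move=> s c sc s1; have := lsyl_reduced sc => sr.
have e1 : prodl iota (map lsyl s) = inL 1%g by rewrite lsylE s1 hom1.
have e2 : prodl iota (map lsyl s) = inB 1%g by rewrite lsylE s1 hom1.
have [|[_ cT]] := reduced_inj iotaM iota_inj sr e1; first by case: (s).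
have [|[_ cF]] := reduced_inj iotaM iota_inj sr e2; first by case: (s).
by rewrite cT in cF.
Qed.

Let step_sep i j : expgz x i = expgz y j -> i = 0 /\ j = 0.
Proof.
move=> ij; have [i0|i0] := eqVneq i 0.
  split=> //; apply/eqP; apply: contraT => j0.
  have /step_free : salt false [:: (false, j)] by rewrite /= j0.
  by rewrite /= mulg1 /syl /= -ij i0 => /(_ erefl).
have [j0|j0] := eqVneq j 0.
  have /step_free : salt true [:: (true, i)] by rewrite /= i0.
  by rewrite /= mulg1 /syl /= ij j0 => /(_ erefl).
have /step_free : salt true [:: (true, i); (false, - j)] by rewrite /= i0 oppr_eq0 j0.
by rewrite /= mulg1 /syl /= ij -expgzD subrr => /(_ erefl).
Qed.

Lemma step_chain : chain_group m k r.+1 b'.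
Proof. by split; [exact: b'_rels|exact: b'_univ|exact: step_sep]. Qed.

Lemma step_twisted : twisted x (b' r) y.
Proof.
have [e gb] := bs_conj mr kr mkr; exists e.
have aE : b' r = inB ba by rewrite /b' leqnn br_ba.
set g0 := (expgz ba e * bb * expgz ba (- e))%g in gb.
have -> : (expgz (b' r) e * y * expgz (b' r) (- e))%g = inB g0.
  by rewrite aE yE -!hom_expgz // -!inBM.
clearbody g0.
have yz z : expgz y z = inB (expgz bb z) by rewrite yE hom_expgz.
(* The double coset form of [bs_conj]: powers of y can be absorbed on both sides of g without
   reaching the amalgamated subgroup. *)
have sandwich j j' : ~ inC iota (expgz bb j * g0 * expgz bb j' : E false)%g.
  case=> z /= h; apply: (gb (- j) z (- j')).
  by rewrite -[expgz ba z]h !expgzN -!mulgA mulgV mulg1 mulKg.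
have notpow j : g0 <> expgz bb j.
  by move=> h; apply: (gb j 0 0); rewrite !mulg1.
have out u : (forall j, u <> expgz bb j) -> outside x y (inB u).
  move=> hu s c sc /esym /(lsyl_inB sc)[j [uj _]]; exact: hu uj.
split; last first.
  rewrite aE -!(homV _ inBM) -!inBM; split; [| | |split]; apply: out => j h.
  - exact: notpow h.
  - by apply: (notpow (- j)); rewrite expgzN -h invgK.
  - by have [] := bs_sep mr kr mkr (i := 1) h.
  - apply: (gb 0 1 (- j)); rewrite mul1g expgzN -h invgM invgK.
    exact: (esym (mulVKg ba g0)).
  - apply: (gb 0 (-1) (- j)); rewrite mul1g expgzN -h invgM !invgK.
    exact: (esym (mulKg ba g0)).
  exact: bs_conj_gen h.
move=> s s' c c' sc s'c' h.
have inM M g1 : salt true M -> odd (size M) -> ~ @inC E zgroup iota false g1 ->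
    reduced iota true (map lsyl M ++ [:: @mkl E false g1]).
  move=> Mt Mo g1C; apply: reduced_cat; first exact: lsyl_reduced.
  by rewrite size_map Mo.
have inM2 M g1 : salt true M -> ~ @inC E zgroup iota false g1 ->
    reduced iota false (@mkl E false g1 :: map lsyl M).
  by move=> Mt g1C; split => //; exact: lsyl_reduced.
have MnB M u : salt true M -> odd (size M) -> evs x y M <> inB u.
  move=> Mt Mo Mu; have := reduced_inj iotaM iota_inj (lsyl_reduced Mt) (etrans (lsylE M) Mu).
  by case=> [|[]//]; case: (M) Mo.
have solve (p M q z : P) : z = (p * M * q)%g -> M = (p^-1 * z * q^-1)%g.
  by move=> ->; rewrite !mulgA mulVg mul1g mulgK.
have [[j sj]|[i [j [M [Mt Mo sM]]]]] := evs_trim sc;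
  have [[j' sj']|[i' [j' [M' [Mt' Mo' sM']]]]] := evs_trim s'c'.
- by split; [exists j|exists j'].
- exfalso; apply: (MnB M' (expgz bb (- i') * (g0^-1 * (expgz bb j * g0)) * expgz bb (- j'))%g) => //.
  rewrite !inBM (homV _ inBM) -!yz !expgzN.
  by apply: solve; rewrite -(sM' P) -(sj P x) h mulKg.
- exfalso; apply: (MnB M (expgz bb (- i) * (g0 * expgz bb j' * g0^-1) * expgz bb (- j))%g) => //.
  rewrite !inBM (homV _ inBM) -!yz !expgzN.
  by apply: solve; rewrite -(sM P) -(sj' P x) -h mulgK.
(* With both cores present, M (y^j g y^-j') = (y^-i g y^i') M' equates a reduced word starting in L
   with one starting in B. *)
exfalso; have := reduced_tags iotaM iota_inj (inM M _ Mt Mo (sandwich j (- j')))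
  (inM2 M' _ Mt' (sandwich (- i) i')).
have -> : prodl iota (map lsyl M ++ [:: @mkl E false (expgz bb j * g0 * expgz bb (- j'))%g]) =
    prodl iota (@mkl E false (expgz bb (- i) * g0 * expgz bb i')%g :: map lsyl M').
  rewrite prodl_cat lsylE [prodl _ (_ :: map _ _)]/= lsylE [prodl _ [:: _]]/= mulg1.
  rewrite -!/(inB _) !inBM -!yz !expgzN.
  rewrite (sM P) (sM' P) in h.
  have := solve (expgz y i) (evs x y M) (expgz y j) _ (esym (canRL (mulgK (inB g0)) h)).
  by move=> ->; rewrite -!mulgA !mulKg mulgV mulg1.
move=> /(_ erefl); case: (M) Mt Mo => // t M1 /= /andP[/eqP tT _] _.
by rewrite /lsyl tT.
Qed.

Lemma chain_step : exists (L' : groupType) (c : nat -> L'),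
  [/\ chain_group m k r.+1 c, free_pair (c 0%N) (c r.+1) &
      twisted (c 0%N) (c r) (c r.+1)].
Proof.
by exists P, b'; split; [exact: step_chain|exact: step_free|exact: step_twisted].
Qed.

End ChainStep.

Section ChainExists.
Variables (m k : nat -> int).
Hypothesis m0 : forall i, m i != 0.
Hypothesis k0 : forall i, k i != 0.
Hypothesis mk : forall i, `|m i| != `|k i|.

Lemma chain_base : exists (L : groupType) (b : nat -> L), chain_group m k 1 b.
Proof.
exists (bs_group (m 0%N) (k 0%N)), (fun i => bs_gen (m 0%N) (k 0%N) (i == 0%N)).
split=> [[|//] _|H f frel|i j].
- exact: bs_rel.
- have [h [hM ha hb]] := bs_univ (frel 0%N isT).
  by exists h; split => // -[|[|]].
exact: bs_sep.
Qed.

Lemma chain_exists r : exists (L : groupType) (b : nat -> L),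
  [/\ chain_group m k r.+2 b, free_pair (b 0%N) (b r.+2) &
      twisted (b 0%N) (b r.+1) (b r.+2)].
Proof.
elim: r => [|r [L [b [bC _ _]]]]; last exact: (chain_step bC).
by have [L [b bC]] := chain_base; exact: (chain_step bC).
Qed.

End ChainExists.

(** * Higman groups *)

Section FreeGroup2.

Definition free2 : groupType := presented (set0 : set (word bool * word bool)).
Definition fgen (c : bool) : free2 := pres_gen set0 c.

Lemma free2_univ (H : groupType) (x y : H) : exists h : free2 -> H,
  {morph h : u v / (u * v)%g} /\ forall s, h (evs (fgen true) (fgen false) s) = evs x y s.
Proof.
have [//|h [[hM hgen] _]] := @pres_univ _ set0 H (fun c => if c then x else y).
by exists h; split => // s; rewrite (evs_morph _ _ _ hM) !hgen.
Qed.

Lemma free2_word (p : free2) : exists s c, salt c s /\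
  p = evs (fgen true) (fgen false) s.
Proof.
have [s [[c sc] sE]] := word_syl (repr p); exists s, c; split => //.
by rewrite -(pres_classK p) -pres_evalw sE.
Qed.

Lemma free2_inj (H : groupType) (x y : H) (h : free2 -> H) : free_pair x y ->
  {morph h : u v / (u * v)%g} ->
  (forall s, h (evs (fgen true) (fgen false) s) = evs x y s) -> injective h.
Proof.
move=> xy hM hE p q pq.
have hV u : h (u^-1)%g = ((h u)^-1)%g.
  apply: (@mulgI _ (h u)); rewrite -hM !mulgV.
  exact: (evs_morph 1%g 1%g [::] hM).
apply: divg1_eq; have [s [c [sc sE]]] := free2_word (p * q^-1)%g.
rewrite sE (xy _ _ sc) // -hE -sE hM hV pq mulgV //.
Qed.

(** The generators a_0 and a_2 are the first and last of one chain group but the last and first of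
    the other; this exchanges their roles in words. *)
Definition sflip (s : seq (bool * int)) := [seq (~~ t.1, t.2) | t <- s].

Lemma evs_flip (G : groupType) (x y : G) s : evs x y (sflip s) = evs y x s.
Proof. by elim: s => //= -[[] z] s ->. Qed.

Lemma salt_flip c s : salt c s -> salt (~~ c) (sflip s).
Proof. by elim: s c => //= -[e z] s IHs c /and3P[/eqP -> -> /IHs ->]; rewrite eqxx. Qed.

Lemma free_pairC (L : groupType) (x y : L) : free_pair x y -> free_pair y x.
Proof.
move=> xy s c sc; rewrite -evs_flip => /(xy _ _ (salt_flip sc)).
by case: (s).
Qed.

End FreeGroup2.

Section Higman.
Variables (R : realType) (n : nat) (m k : 'I_n.+4 -> int).
Hypothesis m0 : forall i, m i != 0.
Hypothesis k0 : forall i, k i != 0.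
Hypothesis mk : forall i, `|m i| != `|k i|.

Let G := higman_group m k.
Let gen (i : 'I_n.+4) : G := pres_gen (higman_rels m k) i.
Let ix (j : nat) : 'I_n.+4 := inord (j %% n.+4).

Let ixS j : ordS (ix j) = ix j.+1.
Proof.
apply: val_inj; rewrite /= /ix !inordK ?ltn_pmod // -addn1 modnDml addn1 //.
Qed.

Let ixE (i : 'I_n.+4) : ix i = i.
Proof. by apply: val_inj; rewrite /= inordK ?ltn_pmod // modn_small. Qed.

Let gen_rel (s : nat) i :
  chain_rel (fun j => m (ix (j + s))) (fun j => k (ix (j + s)))
    (fun j => gen (ix (j + s))) i.
Proof. by rewrite /chain_rel addSn -ixS; exact: higman_relE. Qed.

Theorem higman_acylindrically_hyperbolic : acylindrically_hyperbolic R G.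
Proof.
have [A [b [bC bF [eA [bT [_ X1 a1 [Xa1 XaV1 XaX1]]]]]]] :=
  chain_exists (fun j => m0 (ix (j + 0))) (fun j => k0 (ix (j + 0)))
    (fun j => mk (ix (j + 0))) 0.
have [B [c [cC cF [eB [cT [Y1 _ _ _]]]]]] :=
  chain_exists (fun j => m0 (ix (j + 2))) (fun j => k0 (ix (j + 2)))
    (fun j => mk (ix (j + 2))) n.
set gA := (_ * _ * _)%g in bT X1 a1 Xa1 XaV1 XaX1.
set gB := (_ * _ * _)%g in cT Y1.
have [hA [hAM hAE]] := free2_univ (b 0%N) (b 2).
have [hB [hBM hBE]] := free2_univ (c n.+2) (c 0%N).
have hA_inj := free2_inj bF hAM hAE.
have hB_inj := free2_inj (free_pairC cF) hBM hBE.
pose E (x : bool) : groupType := if x then A else B.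
pose iota (x : bool) : free2 -> E x := if x return free2 -> E x then hA else hB.
have iotaM x : {morph iota x : u v / (u * v)%g} by case: x.
have iota_inj x : injective (iota x) by case: x.
pose P := amalgam iota.
pose inA (x : A) : P := @inj E free2 iota true x.
pose inB (x : B) : P := @inj E free2 iota false x.
have inAM : {morph inA : u v / (u * v)%g} by exact: (injM iota (b := true)).
have inBM : {morph inB : u v / (u * v)%g} by exact: (injM iota (b := false)).
have glue u : inA (hA u) = inB (hB u) by exact: (inj_iota iota true false u).
have hz (K H : groupType) (h : K -> H) x z : {morph h : u v / (u * v)%g} ->
    h (expgz x z) = expgz (h x) z.
  by move=> hM; have := evs_morph x x [:: (true, z)] hM; rewrite /= !mulg1.
have hV (K H : groupType) (h : K -> H) x : {morph h : u v / (u * v)%g} ->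
    h (x^-1)%g = ((h x)^-1)%g by move=> hM; exact: hz K H h x (-1) hM.
have gt : evs (fgen true) (fgen false) [:: (true, 1)] = fgen true.
  by rewrite /= mulg1 /syl /= expg1.
have gf : evs (fgen true) (fgen false) [:: (false, 1)] = fgen false.
  by rewrite /= mulg1 /syl /= expg1.
have hAt : hA (fgen true) = b 0%N by rewrite -gt hAE /= mulg1 /syl /= expg1.
have hAf : hA (fgen false) = b 2 by rewrite -gf hAE /= mulg1 /syl /= expg1.
have hBt : hB (fgen true) = c n.+2 by rewrite -gt hBE /= mulg1 /syl /= expg1.
have hBf : hB (fgen false) = c 0%N by rewrite -gf hBE /= mulg1 /syl /= expg1.
have glue0 : inA (b 0%N) = inB (c n.+2) by rewrite -hAt -hBt glue.
have glue2 : inA (b 2) = inB (c 0%N) by rewrite -hAf -hBf glue.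
(* Generators 0 and 1 are sent to A and all others to B; [glue0] and [glue2] serve the relations
   that cross from one factor to the other. *)
pose phi (i : 'I_n.+4) : P := if (i < 2)%N then inA (b i) else inB (c (i - 2)%N).
have phi0 : phi (ix 0) = inA (b 0%N) by rewrite /phi /= inordK.
have phi1 : phi (ix 1) = inA (b 1%N) by rewrite /phi /= inordK.
have phiB j : (j <= n.+2)%N -> phi (ix (j + 2)) = inB (c j).
  rewrite leq_eqVlt => /predU1P[->|jn].
    by rewrite addn2 /ix modnn phi0 glue0.
  by rewrite /phi /ix modn_small ?inordK ?addn2 //= subn2.
have phi2 : phi (ix 2) = inA (b 2) by rewrite (phiB 0%N) // glue2.
have chain_hom (K H : groupType) (h : K -> H) mu ka (d : nat -> K) i :
    {morph h : u v / (u * v)%g} -> chain_rel mu ka d i -> chain_rel mu ka (h \o d) i.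
  by move=> hM; rewrite /chain_rel /= -!hz // -(hV _ _ h) // -!hM => ->.
have phi_rel i : (phi i * expgz (phi (ordS i)) (m i) * (phi i)^-1)%g =
    expgz (phi (ordS i)) (k i).
  rewrite -(ixE i) ixS; case: (ltnP i 2) => i2.
    have := chain_hom _ _ _ _ _ _ _ inAM (chain_rels bC i2).
    rewrite /chain_rel /= addn0.
    by case: i i2 => -[|[|//]] //= _ _; rewrite ?phi0 ?phi1 ?phi2.
  have i2n : (i - 2 < n.+2)%N by have := ltn_ord i; lia.
  have := chain_hom _ _ _ _ _ _ _ inBM (chain_rels cC i2n).
  rewrite /chain_rel /= -!phiB //; last exact: ltnW.
  by rewrite addSn subnK.
have [|f [[fM fphi] _]] := @pres_univ _ (higman_rels m k) P phi.
  move=> u v [i _ uv]; have uE : _ ++ _ ++ _ = u := congr1 fst uv.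
  have vE : wexpz _ _ = v := congr1 snd uv; rewrite -uE -vE /=.
  by rewrite evalw_cat !evalw_wexpz /= mulg1 mulgA; exact: phi_rel.
have [g1 [g1M g1E]] := chain_univ bC (fun i _ => gen_rel 0 i).
have [g2 [g2M g2E]] := chain_univ cC (fun i _ => gen_rel 2 i).
pose gE (x : bool) : E x -> G := if x return E x -> G then g1 else g2.
have ix0 : ix (n.+2 + 2) = ix 0 by rewrite /ix addn2 modnn mod0n.
have [||h [hM hE]] := @amalgam_univ E free2 iota G gE.
- by case.
- move=> u; have [s [d [_ ->]]] := free2_word u; rewrite /iota /gE hAE hBE.
  by rewrite (evs_morph _ _ _ g1M) (evs_morph _ _ _ g2M) !g1E // !g2E // ix0.
have hphi i : h (phi i) = gen i.
  have hA' x : h (inA x) = g1 x := hE true x.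
  have hB' x : h (inB x) = g2 x := hE false x.
  rewrite /phi; case: ltnP => i2; rewrite ?hA' ?hB' ?g1E ?g2E ?addn0 ?subnK ?ixE //.
  - exact: ltnW.
  - by have := ltn_ord i; lia.
(* Injectivity of f comes from a left inverse: [h \o f] and the identity agree on generators, hence
   everywhere by uniqueness. *)
have hf u : h (f u) = u.
  have [u0 [_ uniq]] := @pres_univ _ (higman_rels m k) G gen (fun _ _ => @pres_rels _ _ _ _).
  rewrite -[LHS]/((h \o f) u) -(uniq (h \o f)) ?(uniq id) //.
  by split=> [x y|i] /=; rewrite ?fM ?hM // fphi hphi.
have f_inj : injective f := can_inj hf.
pose uA := (expgz (gen (ix 1)) eA * gen (ix 2) * expgz (gen (ix 1)) (- eA))%g.
pose uB := (expgz (gen (ix (n.+1 + 2))) eB * gen (ix (n.+2 + 2)) *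
            expgz (gen (ix (n.+1 + 2))) (- eB))%g.
have fuA : f uA = inA gA.
  by rewrite /uA /gA !fM !inAM !(hz _ _ f) // !(hz _ _ inA) // !fphi phi1 phi2.
have fuB : f uB = inB gB.
  by rewrite /uB /gB !fM !inBM !(hz _ _ f) // !(hz _ _ inB) // !fphi !phiB.
clearbody uA uB.
have notA x : outside (b 0%N) (b 2) x -> ~ @inC E free2 iota true x.
  by move=> ox [u xu]; have [s [d [sd uE]]] := free2_word u;
    apply: (ox s d sd); rewrite -hAE -uE.
have notB x : outside (c 0%N) (c n.+2) x -> ~ @inC E free2 iota false x.
  move=> ox [u xu]; have [s [d [sd uE]]] := free2_word u.
  by apply: (ox _ _ (salt_flip sd)); rewrite evs_flip -hBE -uE.
pose X : E true := (gA^-1)%g.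
apply: (@amalgam_acylindrically_hyperbolic E free2 iota iotaM iota_inj X (b 1%N) gB
  _ _ _ _ _ _ _ R G f ((uB * uA^-1 * uB * uA^-1)^-1)%g (gen (ix 1))) => //.
- exact: notA.
- exact: notA.
- exact: notA.
- exact: notA.
- by rewrite /X invgK; exact: notA.
- exact: notB.
(* The relation with Y makes c2 a power of a_0, the one with X makes it a power of a_2, and by
   [chain_ends] in A these meet trivially. *)
- move=> c1 c2 c3 Yc Xc; have [s1 [d1 [sd1 c1E]]] := free2_word c1.
  have [s2 [d2 [sd2 c2E]]] := free2_word c2; have [s3 [d3 [sd3 c3E]]] := free2_word c3.
  have [|[j cj] _] := cT _ _ _ _ (salt_flip sd2) (salt_flip sd1).
    by rewrite !evs_flip -!hBE -c1E -c2E; exact: esym.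
  have [|[i ci] _] := bT _ _ _ _ sd2 sd3.
    have Xc' : (gA^-1 * hA c2 = hA c3 * gA^-1)%g by exact: Xc.
    by rewrite -!hAE -c2E -c3E; apply: (@mulgI _ gA^-1%g); rewrite mulKg mulgA Xc' mulgVK.
  have ej : c2 = expgz (fgen true) j.
    by apply: hB_inj; rewrite c2E hBE -evs_flip cj (hz _ _ hB) // hBt.
  have ei : c2 = expgz (fgen false) i.
    by apply: hA_inj; rewrite c2E hAE ci (hz _ _ hA) // hAf.
  have : expgz (b 0%N) j = expgz (b 2) i.
    by have := congr1 hA (etrans (esym ej) ei); rewrite !(hz _ _ hA) // hAt hAf.
  by case/(chain_ends bC) => j0 _; rewrite ej j0.
- by rewrite invgK !fM (hV _ _ f) // fuA fuB /X (injV iota).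
- by rewrite fphi phi1.
Qed.

End Higman.

Theorem corollary12 (R : realType) :
  (forall (n : nat) (m k : 'I_n -> int),
     (5 <= n)%N ->
     (forall i : 'I_n, [/\ m i != 0, k i != 0 & `|m i| != `|k i|]) ->
     acylindrically_hyperbolic R (higman_group m k)) /\
  (forall m : 'I_4 -> int,
     (forall i : 'I_4, 2 <= m i) ->
     acylindrically_hyperbolic R (higman_group (fun _ : 'I_4 => 1) m)).
Proof.
(* Both families are instances with at least four generators; in the second, the absolute values 1
   and m_i >= 2 differ. *)
split=> [[|[|[|[|n]]]] // m k _ mk|m m2]; apply: higman_acylindrically_hyperbolic.
- by move=> i; have [] := mk i.
- by move=> i; have [] := mk i.
- by move=> i; have [] := mk i.
- by [].
- by move=> i; have := m2 i; lia.
- by move=> i; have := m2 i; lia.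
Qed.
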